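(* Let $b$ be a prime and $d\ge1$. There is a constant $C_{b,d}>0$ depending only on $b$ and $d$ such that the following holds. Let $K=\mathbb{F}_b((x^{-1}))$, $A=\mathbb{F}_b[x]$, $T\in\mathrm{GL}_d(K)$, and let $\mathbb{X}=T(A^d)$ be admissible. Let $T=L'Q$ where $L'=(l'_{ij})\in K^{d\times d}$ is lower triangular and $Q\in\mathbb{F}_b[[x^{-1}]]^{d\times d}$ with $\det Q=1$, and let $\boldsymbol f=(f_1,\dots,f_d)\in K^d$ with $\deg(f_j)\ge0$ and $\deg(f_j)\ge\max_{1\le i\le j}\deg(l'_{ji})$ for all $1\le j\le d$. Let $\mathcal{P}_{\boldsymbol f,d}=\boldsymbol f^{-1}\mathbb{X}\cap\mathbb{U}^d_b$, which is a $(t,m,d)$-net in $\mathbb{U}^d_b$ with $t=-\deg(\det T)-M(\mathbb{X})-d+1$ and $m=-\deg(\det T)+\sum_{j=1}^d\deg(f_j)$, and let $$N_{\boldsymbol f}=|\mathcal{P}_{\boldsymbol f,d}|=b^{-\deg(\det T)+\sum_{j=1}^d\deg(f_j)}.$$ Then the star-discrepancy of $\phi(\mathcal{P}_{\boldsymbol f,d})$ satisfies $$D^*(\phi(\mathcal{P}_{\boldsymbol f,d}))\le C_{b,d}\,b^t\,\frac{(\log_bN_{\boldsymbol f}-t)^{d-1}}{N_{\boldsymbol f}}=C_{b,d}\,\frac{\bigl(\sum_{j=1}^d\deg(f_j)+M(\mathbb{X})+d-1\bigr)^{d-1}}{b^{\sum_{j=1}^d\deg(f_j)+M(\mathbb{X})+d-1}}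 .$$
   Context: $\mathbb{F}_b$ is the field with $b$ elements, identified with $\{0,1,\dots,b-1\}$. $K=\mathbb{F}_b((x^{-1}))$ is the field of formal Laurent series $\sum_{i=w}^\infty c_ix^{-i}$ ($w\in\mathbb{Z}$, $c_i\in\mathbb{F}_b$), and $A=\mathbb{F}_b[x]\subset K$. For $f=\sum_{i\ge w}c_ix^{-i}$ with $c_w\ne0$, $\deg(f)=-w$; $\deg(0)=-\infty$. $\mathbb{F}_b[[x^{-1}]]=\{f\in K:\deg f\le0\}$. $\mathbb{U}^d_b=\{(g_1,\dots,g_d)\in K^d:\deg(g_j)<0\ \forall j\}$. $\boldsymbol f^{-1}\mathbb{X}=\{(f_1^{-1}g_1,\dots,f_d^{-1}g_d):(g_1,\dots,g_d)\in\mathbb{X}\}$. The map $\phi:K\to\mathbb{R}$, $\phi(\sum_{i\ge w}c_ix^{-i})=\sum_{i\ge w}c_ib^{-i}$, is applied componentwise to vectors. Dual lattice: $\mathbb{X}^\perp=\{\boldsymbol g\in K^d:\sum_jg_jh_j\in A\text{ for all }\boldsymbol h\in\mathbb{X}\}$. $M(\mathbb{X})=\inf_{\boldsymbol g\in\mathbb{X}^\perp\setminus\{\boldsymbol0\}}\sum_{j=1}^d\deg(g_j)$. $\mathbb{X}$ is admissible if $M(\mathbb{X})>-\infty$. $(t,m,d)$-net in $\mathbb{U}^d_b$ (for integers $m\ge1$, $0\le t\le m$, $d\ge1$): a set of $b^m$ points of $\mathbb{U}^d_b$ such that for all nonnegative integers $l_1,\dots,l_d$ with $l_1+\dots+l_d=m-t$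 and all $h_j\in\{c_1x^{-1}+\dots+c_{l_j}x^{-l_j}:c_i\in\mathbb{F}_b\}$ ($1\le j\le d$), the set $\{\boldsymbol g\in\mathbb{U}^d_b:\deg(g_j-h_j)<-l_j\text{ for all }1\le j\le d\}$ contains exactly $b^t$ of the points. Star-discrepancy of a finite point (multi)set $P$ in $[0,1]^d$: $D^*(P)=\sup_J\bigl|\frac{|P\cap J|}{|P|}-\lambda_d(J)\bigr|$, where $J$ ranges over axes-parallel boxes $J=\prod_{j=1}^d[0,y_j)\subseteq[0,1)^d$ with one vertex at the origin, $\lambda_d(J)$ is the volume of $J$, and points are counted with multiplicity; $\phi(\mathcal{P}_{\boldsymbol f,d})$ is understood as the multiset $(\phi(\boldsymbol g))_{\boldsymbol g\in\mathcal{P}_{\boldsymbol f,d}}$ with $N_{\boldsymbol f}$ elements.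
   Formalization: For d ≥ 2 the discrepancy bound is asserted only when t < m, since at t = m its right side is 0 while the star-discrepancy is positive; the net property is asserted only when m ≥ 1 and t ≤ m, as the definition of a (t,m,d)-net requires. *)

(* Defs.v *)
From HB Require Import structures.
From mathcomp Require Import all_boot all_order all_algebra.
From mathcomp Require Import all_classical all_reals all_analysis.
From mathcomp Require Import finmap zify.

Set Implicit Arguments.
Unset Strict Implicit.
Unset Printing Implicit Defensive.

Import Order.TTheory GRing.Theory Num.Theory.

Local Open Scope classical_set_scope.
Local Open Scope ring_scope.

Definition lbounded (F : fieldType) (c : int -> F) : Prop :=
  exists w : int, forall i, i < w -> c i = 0.

(* Formal Laurent series \sum_(i >= w) c_i x^{-i}: the coefficient of x^{-i}
   (not of x^i) is [lcoef f i]. *)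
Record laurent (F : fieldType) := Laurent {
  lcoef : int -> F;
  lcoefP : lbounded lcoef }.

HB.instance Definition _ (F : fieldType) := gen_eqMixin (laurent F).
HB.instance Definition _ (F : fieldType) := gen_choiceMixin (laurent F).

Section LaurentField.
Variable F : fieldType.
Implicit Types f g h : laurent F.

Lemma laurentP f g : lcoef f =1 lcoef g -> f = g.
Proof.
case: f g => [c cP] [d dP] /= /funext cd; case: _ / cd dP => dP.
by congr Laurent; apply: Prop_irrelevance.
Qed.

Fact lzero_subproof : lbounded (fun=> 0 : F).
Proof. by exists 0. Qed.
Definition lzero := Laurent lzero_subproof.

Fact lopp_subproof f : lbounded (fun i => - lcoef f i).
Proof. by have [w fw] := lcoefP f; exists w => i /fw ->; rewrite oppr0. Qed.
Definition lopp f := Laurent (lopp_subproof f).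

Fact ladd_subproof f g : lbounded (fun i => lcoef f i + lcoef g i).
Proof.
have [v fv] := lcoefP f; have [w gw] := lcoefP g.
by exists (Num.min v w) => i; rewrite lt_min => /andP[/fv -> /gw ->]; rewrite addr0.
Qed.
Definition ladd f g := Laurent (ladd_subproof f g).

Fact laddA : associative ladd.
Proof. by move=> f g h; apply: laurentP => i /=; rewrite addrA. Qed.
Fact laddC : commutative ladd.
Proof. by move=> f g; apply: laurentP => i /=; rewrite addrC. Qed.
Fact ladd0 : left_id lzero ladd.
Proof. by move=> f; apply: laurentP => i /=; rewrite add0r. Qed.
Fact laddN : left_inverse lzero lopp ladd.
Proof. by move=> f; apply: laurentP => i /=; rewrite addNr. Qed.

HB.instance Definition _ :=
  GRing.isZmodule.Build (laurent F) laddA laddC ladd0 laddN.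

Definition lmulc f g (n : int) : F :=
  \sum_(i \in [set: int]) lcoef f i * lcoef g (n - i).

(* truncations, used to reduce the ring laws to those of {poly F} *)
Let trunc f (v : int) N : {poly F} := \poly_(k < N) lcoef f (v + k%:Z).

Lemma lmulcE f g v w (n N : nat) :
    (forall i, i < v -> lcoef f i = 0) -> (forall i, i < w -> lcoef g i = 0) ->
    (n < N)%N ->
  lmulc f g (v + w + n%:Z) = (trunc f v N * trunc g w N)`_n.
Proof.
move=> fv gw nN; rewrite coefM /lmulc.
rewrite (fsbigE [seq v + k%:Z | k <- iota 0 n.+1]); first last.
- move=> i _ iNr; have [iv|vi] := ltP i v; first by rewrite fv ?mul0r.
  rewrite [lcoef g _]gw ?mulr0//; rewrite ltNge; apply/negP => le_i.
  move/negP: iNr; apply; apply/mapP; exists `|i - v|%N; last by lia.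
  by rewrite mem_iota; lia.
- by [].
- by rewrite map_inj_uniq ?iota_uniq// => x y; lia.
rewrite big_map -[iota _ _]/(index_iota 0 n.+1) big_mkord big_mkcond /=.
apply: eq_bigr => k _; rewrite in_setT !coef_poly.
have -> : (k < N)%N by have := ltn_ord k; lia.
have -> : (n - k < N)%N by lia.
by congr (_ * lcoef g _); have := ltn_ord k; lia.
Qed.

Lemma lmulc_lt f g v w (n : int) :
    (forall i, i < v -> lcoef f i = 0) -> (forall i, i < w -> lcoef g i = 0) ->
  n < v + w -> lmulc f g n = 0.
Proof.
move=> fv gw nvw; apply: fsbig1 => i _.
have [iv|vi] := ltP i v; first by rewrite fv ?mul0r.
by rewrite [lcoef g _]gw ?mulr0//; lia.
Qed.

Fact lmul_subproof f g : lbounded (lmulc f g).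
Proof.
have [v fv] := lcoefP f; have [w gw] := lcoefP g.
by exists (v + w) => n; apply: lmulc_lt.
Qed.
Definition lmul f g := Laurent (lmul_subproof f g).

(* [lmonom c n] is c x^{-n}. *)
Fact lmonom_subproof (c : F) (n : int) : lbounded (fun i => c *+ (i == n)).
Proof. by exists n => i; case: eqP => [->|//]; rewrite ltxx. Qed.
Definition lmonom c n := Laurent (lmonom_subproof c n).

Let coefM_eq (p p' q q' : {poly F}) n :
    (forall k, (k <= n)%N -> p`_k = p'`_k) ->
    (forall k, (k <= n)%N -> q`_k = q'`_k) -> (p * q)`_n = (p' * q')`_n.
Proof.
move=> pp qq; rewrite !coefM; apply: eq_bigr => k _.
by rewrite pp ?qq//; have := ltn_ord k; lia.
Qed.

Let lsplit (n v : int) : n < v \/ exists k : nat, n = v + k%:Z.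
Proof.
have [nv|vn] := ltP n v; [by left|right].
by exists `|n - v|%N; lia.
Qed.

Fact lmulC : commutative lmul.
Proof.
move=> f g; apply: laurentP => n /=.
have [v fv] := lcoefP f; have [w gw] := lcoefP g.
case: (lsplit n (v + w)) => [nvw|[k ->]].
  by rewrite (lmulc_lt fv gw)// (lmulc_lt gw fv)// addrC.
rewrite (lmulcE fv gw (ltnSn k)) [v + w]addrC.
by rewrite (lmulcE gw fv (ltnSn k)) mulrC.
Qed.

Fact lmulA : associative lmul.
Proof.
move=> f g h; apply: laurentP => n /=.
have [u fu] := lcoefP f; have [v gv] := lcoefP g; have [w hw] := lcoefP h.
have fgP i : i < u + v -> lcoef (lmul f g) i = 0 by apply: lmulc_lt.
have ghP i : i < v + w -> lcoef (lmul g h) i = 0 by apply: lmulc_lt.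
case: (lsplit n (u + v + w)) => [lt_n|[k ->]].
  by rewrite (lmulc_lt fgP hw)// (lmulc_lt fu ghP)// addrA.
rewrite (lmulcE fgP hw (ltnSn k)) -(addrA u) (lmulcE fu ghP (ltnSn k)).
transitivity ((trunc f u k.+1 * (trunc g v k.+1 * trunc h w k.+1))`_k).
  apply: coefM_eq => // i ik; rewrite coef_poly ltnS ik /=.
  by rewrite (@lmulcE _ _ _ _ _ k.+1).
rewrite mulrA; apply: coefM_eq => // i ik; rewrite coef_poly ltnS ik /=.
by rewrite (@lmulcE _ _ _ _ _ k.+1).
Qed.

Fact lmul1 : left_id (lmonom 1 0) lmul.
Proof.
move=> f; apply: laurentP => n /=; rewrite /lmulc.
rewrite (fsbigE [:: 0])//=.
- by rewrite big_mkcond big_seq1 in_setT subr0 mul1r.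
- by move=> i _; rewrite inE => /negPf ->; rewrite mul0r.
Qed.

Fact lmulDl : left_distributive lmul ladd.
Proof.
move=> f g h; apply: laurentP => n /=.
have [u0 fu0] := lcoefP f; have [v0 gv0] := lcoefP g; have [w hw] := lcoefP h.
pose u := Num.min u0 v0.
have fu i : i < u -> lcoef f i = 0 by rewrite lt_min => /andP[/fu0].
have gu i : i < u -> lcoef g i = 0 by rewrite lt_min => /andP[_ /gv0].
have fgu i : i < u -> lcoef (ladd f g) i = 0.
  by move=> iu /=; rewrite fu ?gu ?addr0.
case: (lsplit n (u + w)) => [lt_n|[k ->]].
  by rewrite (lmulc_lt fgu hw)// (lmulc_lt fu hw)// (lmulc_lt gu hw)// addr0.
rewrite (lmulcE fgu hw (ltnSn k)) (lmulcE fu hw (ltnSn k)).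
rewrite (lmulcE gu hw (ltnSn k)) -coefD -mulrDl.
by apply: coefM_eq => // i ik; rewrite coefD !coef_poly ltnS ik.
Qed.

Fact lone_neq0 : lmonom 1 0 != 0 :> laurent F.
Proof.
apply/eqP => /(congr1 (@lcoef F)) /(congr1 (fun c => c 0)) /eqP.
by rewrite /= oner_eq0.
Qed.

HB.instance Definition _ := GRing.Zmodule_isComNzRing.Build (laurent F)
  lmulA lmulC lmul1 lmulDl lone_neq0.

(* the least i with nonzero coefficient; junk value 0 if f = 0 *)
Definition lord f : int :=
  xget 0 [set n | lcoef f n != 0 /\ forall i, i < n -> lcoef f i = 0].

Lemma lordP f : f != 0 ->
  lcoef f (lord f) != 0 /\ forall i, i < lord f -> lcoef f i = 0.
Proof.
move=> f0; rewrite /lord; case: xgetP => [n _ //|noP]; exfalso.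
have [w fw] := lcoefP f; move/eqP: f0; apply; apply: laurentP => n /=.
case: (lsplit n w) => [/fw //|[k ->]].
elim/ltn_ind: k => k IH; apply/eqP/negPn/negP => fk.
apply: (noP (w + k%:Z)); split => // i ik.
case: (lsplit i w) => [/fw //|[j ij]]; rewrite ij; apply: IH; lia.
Qed.

Let invseq (a : nat -> F) := fix s n : seq F :=
  if n is n'.+1 then
    rcons (s n') (((n' == 0)%N%:R - \sum_(k < n') a (n' - k)%N * (s n')`_k) / a 0%N)
  else [::].

Let invseq_size a n : size (invseq a n) = n.
Proof. by elim: n => //= n IH; rewrite size_rcons IH. Qed.

Let invseq_nth a n m k : (k < n <= m)%N -> (invseq a m)`_k = (invseq a n)`_k.
Proof.
elim: m => [|m IH] /andP[kn nm]; first by move: kn nm; lia.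
move: nm; rewrite leq_eqVlt => /predU1P[->//|nm].
by rewrite /= nth_rcons invseq_size IH ?kn//; have -> : (k < m)%N by lia.
Qed.

Lemma laurent_inv f : f != 0 -> exists g, g * f = 1.
Proof.
move=> /lordP[]; set v := lord f => fv0 fv.
pose a k := lcoef f (v + k%:Z); pose c k := (invseq a k.+1)`_k.
have a0 : a 0%N != 0 by rewrite /a addr0.
have cP n : \sum_(k < n.+1) c k * a (n - k)%N = (n == 0)%N%:R.
  rewrite big_ord_recr /= subnn {2}/c /= nth_rcons invseq_size ltnn eqxx.
  rewrite divfK// addrCA -[RHS]addr0; congr (_ + _).
  apply/eqP; rewrite subr_eq0; apply/eqP.
  apply: eq_bigr => k _; rewrite mulrC; congr (_ * _).
  by apply/esym/invseq_nth; rewrite ltnSn ltn_ord.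
have gP : lbounded (fun i => if i < - v then 0 else c (absz (i + v))).
  by exists (- v) => i ->.
exists (Laurent gP); apply: laurentP => n.
have gv i : i < - v -> lcoef (Laurent gP) i = 0 by move=> /= ->.
case: (lsplit n (- v + v)) => [n0|[k ->]].
  rewrite [LHS](lmulc_lt gv fv)//=.
  by move: n0; rewrite addNr; case: eqP => // ->.
rewrite [LHS](lmulcE gv fv (ltnSn k)) coefM addNr add0r /=.
transitivity (\sum_(j < k.+1) c j * a (k - j)%N); last by rewrite cP; case: k.
apply: eq_bigr => j _; rewrite !coef_poly !ltnS leq_subr.
have -> : (j <= k)%N by have := ltn_ord j; lia.
rewrite /=; congr (_ * _); case: ltP => [|_]; first lia.
by congr c; lia.
Qed.

Definition linv f : laurent F :=
  if pselect (exists g, g * f = 1) is left e then projT1 (cid e) else 0.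

Fact lmulVf f : f != 0 -> linv f * f = 1.
Proof.
by move=> /laurent_inv e; rewrite /linv; case: pselect => // e'; case: cid.
Qed.

Fact linv0 : linv 0 = 0.
Proof.
rewrite /linv; case: pselect => // e; exfalso; case: e => g.
by rewrite mulr0 => /eqP; rewrite eq_sym (negPf lone_neq0).
Qed.

HB.instance Definition _ :=
  GRing.ComNzRing_isField.Build (laurent F) lmulVf linv0.

(* deg f = - w if f has leading term c_w x^{-w}, and deg 0 = -oo *)
Definition ldeg f : \bar int := if f == 0 then -oo%E else (- lord f)%:E.

(* the inclusion F[x] `<=` F((x^{-1})) *)
Fact lpoly_subproof (p : {poly F}) :
  lbounded (fun i => if i <= 0 then p`_`|i|%N else 0).
Proof.
exists (- (size p)%:Z) => i ip; case: ifP => // i0.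
apply: nth_default; suff h (n : nat) : i < - n%:Z -> (n <= `|i|)%N by exact: h.
by lia.
Qed.
Definition lpoly p := Laurent (lpoly_subproof p).

End LaurentField.

Section Lattices.
Variables (F : fieldType) (d : nat).

(* T(A^d), with A = F[x] *)
Definition lattice (T : 'M[laurent F]_d) : set 'cV[laurent F]_d :=
  [set T *m map_mx (@lpoly F) a | a in [set: 'cV[{poly F}]_d]].

Definition dual_lattice (X : set 'cV[laurent F]_d) : set 'cV[laurent F]_d :=
  [set g | forall h, X h -> range (@lpoly F) (\sum_j g j 0 * h j 0)].

Definition lattice_min (X : set 'cV[laurent F]_d) : \bar int :=
  infimum +oo%E [set (\sum_j ldeg (g j 0%R))%E | g in dual_lattice X `\ (0 : 'cV_d)].

Definition admissible (X : set 'cV[laurent F]_d) : Prop :=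
  (-oo < lattice_min X)%E.

Definition unit_cube : set 'cV[laurent F]_d :=
  [set g | forall j, (ldeg (g j 0%R) < 0)%E].

(* f^{-1} X *)
Definition cdivide (f : 'cV[laurent F]_d) (X : set 'cV[laurent F]_d) :
    set 'cV[laurent F]_d :=
  [set \col_j ((f j 0)^-1 * g j 0) | g in X].

End Lattices.

Section Nets.
Variables (b d : nat).

Definition is_net (t m : nat) (P : set 'cV[laurent 'F_b]_d) : Prop :=
  [/\ (1 <= m)%N, (t <= m)%N, P `<=` @unit_cube _ d, (P #= `I_(b ^ m)%N)%card &
    forall (l : 'I_d -> nat) (c : 'I_d -> nat -> 'F_b),
      (\sum_j l j)%N = (m - t)%N ->
      let h j := \sum_(1 <= i < (l j).+1) lmonom (c j i) i%:Z in
      (P `&` [set g | forall j, (ldeg (g j 0%R - h j)%R < (- (l j)%:Z)%:E)%E]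
        #= `I_(b ^ t)%N)%card].

(* digits in 'F_b are read as the integers 0, ..., b - 1 *)
Definition lphi (R : realType) (f : laurent 'F_b) : R :=
  limn (series (fun n : nat =>
    (lcoef f (lord f + n%:Z) : nat)%:R * b%:R ^ (- (lord f + n%:Z)) : R^o)).

End Nets.

(* star-discrepancy of the finite multiset (x p)_{p in P}; [0, y) has
   volume \prod_j y_j *)
Definition star_discrepancy (R : realType) (d : nat) (I : choiceType)
    (P : set I) (x : I -> 'cV[R]_d) : \bar R :=
  ereal_sup
    [set (`| #|` fset_set (P `&` [set p | forall j, 0 <= x p j 0 < y j 0]) |%:R
               / #|` fset_set P |%:R
             - \prod_j y j 0 |)%:E
    | y in [set y : 'cV[R]_d | forall j, 0 <= y j 0 <= 1]].

(* Main.v *)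
Require Import Defs.
From HB Require Import structures.
From mathcomp Require Import all_boot all_order all_algebra finmap.
From mathcomp Require Import all_classical all_reals all_analysis.
From mathcomp Require Import zify ring lra.

(* Put M = diag(f^-1) T, a matrix over F_b[[x^-1]], and let U be the unit cube.
   Since K^d = A^d + U directly, U is the direct sum of P = M A^d `&` U and M U.
   As M U = diag(f^-1) L U with diag(f^-1) L lower triangular, a second complement
   of M U in U consists of the vectors of short digit expansions, which gives
   |P| = b^m.  If some nontrivial linear form in the first l_j digits of the
   coordinates vanished on P, the polynomial vector of its coefficients would be
   congruent modulo U to a dual vector y of M A^d with deg y_j < l_j; this
   contradicts the definition of M(X) when \sum_j l_j <= m - t.  Hence the digit
   map is onto and its fibres on P have b^(m - \sum_j l_j) elements: this is the
   net property, and it also forces t >= 0.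
   For the discrepancy, put n = m - t and round a box to b-adic corners with n
   digits.  In all coordinates but one, cut the box into at most b (n + 1)
   elementary intervals; each of the (b (n + 1))^(d-1) pieces so obtained
   contributes an error of at most b^t points. *)

Set Implicit Arguments.
Unset Strict Implicit.
Unset Printing Implicit Defensive.

Import Order.TTheory GRing.Theory Num.Theory.
Local Open Scope classical_set_scope.
Local Open Scope ring_scope.

(* Otherwise [/=] unfolds the coefficients of a product to [lmulc]. *)
#[local] Arguments lcoef : simpl never.

(** * Laurent series *)

Section LaurentTheory.
Variable F : fieldType.
Implicit Types (f g : laurent F) (p q : {poly F}).

(** The condition deg f <= -n on coefficients. It holds for f = 0 and every n, whereas [lord 0] is a
    junk value. *)
Definition lord_ge (n : int) f : Prop := forall i, i < n -> lcoef f i = 0.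

Lemma lcoef0 i : lcoef (0 : laurent F) i = 0. Proof. by []. Qed.

Lemma lcoefD f g i : lcoef (f + g) i = lcoef f i + lcoef g i.
Proof. by []. Qed.

Lemma lcoefN f i : lcoef (- f) i = - lcoef f i. Proof. by []. Qed.

Lemma lcoefB f g i : lcoef (f - g) i = lcoef f i - lcoef g i.
Proof. by []. Qed.

Lemma lcoef_sum I (r : seq I) (Q : pred I) (E : I -> laurent F) i :
  lcoef (\sum_(k <- r | Q k) E k) i = \sum_(k <- r | Q k) lcoef (E k) i.
Proof. by apply: (big_morph (fun f => lcoef f i)). Qed.

Lemma lcoef_monom (c : F) n i : lcoef (lmonom c n) i = c *+ (i == n).
Proof. by []. Qed.

Lemma lcoef_monomM c k f n : lcoef (lmonom c k * f) n = c * lcoef f (n - k).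
Proof.
change (lmulc (lmonom c k) f n = c * lcoef f (n - k)).
rewrite /lmulc (fsbigE [:: k])//=.
- by rewrite big_mkcond big_seq1 in_setT lcoef_monom eqxx.
- by move=> i _; rewrite inE lcoef_monom => /negPf ->; rewrite mulr0n mul0r.
Qed.

Lemma lord_ge_le m n f : m <= n -> lord_ge n f -> lord_ge m f.
Proof. by move=> mn fn i im; apply: fn; apply: lt_le_trans mn. Qed.

Lemma lord_geD n f g : lord_ge n f -> lord_ge n g -> lord_ge n (f + g).
Proof. by move=> fn gn i ni; rewrite lcoefD fn// gn// addr0. Qed.

Lemma lord_geN n f : lord_ge n f -> lord_ge n (- f).
Proof. by move=> fn i ni; rewrite lcoefN fn// oppr0. Qed.

Lemma lord_geB n f g : lord_ge n f -> lord_ge n g -> lord_ge n (f - g).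
Proof. by move=> fn gn; apply/lord_geD/lord_geN. Qed.

Lemma lord_ge_sum n I (r : seq I) (Q : pred I) (E : I -> laurent F) :
  (forall k, Q k -> lord_ge n (E k)) -> lord_ge n (\sum_(k <- r | Q k) E k).
Proof. by move=> En i ni; rewrite lcoef_sum big1// => k /En->. Qed.

Lemma lord_geM m n f g : lord_ge m f -> lord_ge n g -> lord_ge (m + n) (f * g).
Proof. by move=> fm gn i; apply: lmulc_lt. Qed.

Lemma lord_ge01 : lord_ge 0 1.
Proof.
by move=> i i0; change ((1 : F) *+ (i == 0) = 0); case: eqP i0 => // ->.
Qed.

Lemma lord_ge_prod I (r : seq I) (Q : pred I) (E : I -> laurent F) :
  (forall k, Q k -> lord_ge 0 (E k)) -> lord_ge 0 (\prod_(k <- r | Q k) E k).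
Proof.
move=> E0; apply: (big_ind (lord_ge 0)) => //; first exact: lord_ge01.
by move=> f g f0 g0; rewrite -[0]addr0; apply: lord_geM.
Qed.

Lemma lord_geP f : lord_ge (lord f) f.
Proof. by have [->//|/lordP[]] := eqVneq f 0. Qed.
Arguments lord_geP f : clear implicits.

Lemma lord_uniq f n : lcoef f n != 0 -> lord_ge n f -> lord f = n.
Proof.
move=> fn0 fn; have f0 : f != 0 by apply: contraNneq fn0 => ->; rewrite lcoef0.
have [f0' fl] := lordP f0; apply/eqP; rewrite eq_le !leNgt; apply/andP; split.
  by apply: contraNN fn0 => /fl ->.
by apply: contraNN f0' => /fn ->.
Qed.

Lemma lord_ge_lord f n : f != 0 -> lord_ge n f <-> n <= lord f.
Proof.
move=> f0; split=> [fn|nf]; last by apply: lord_ge_le nf (lord_geP f).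
by have [f0' _] := lordP f0; rewrite leNgt; apply: contraNN f0' => /fn ->.
Qed.

Lemma lcoefM_lord f g :
  lcoef (f * g) (lord f + lord g) = lcoef f (lord f) * lcoef g (lord g).
Proof.
rewrite -[lord f + _]addr0.
rewrite [LHS](@lmulcE _ _ _ _ _ 0%N 1%N (lord_geP f) (lord_geP g) isT).
by rewrite coefM big_ord1 !coef_poly/= !addr0.
Qed.

Lemma lordM f g : f != 0 -> g != 0 -> lord (f * g) = lord f + lord g.
Proof.
move=> f0 g0; apply: lord_uniq; last exact: lord_geM (lord_geP f) (lord_geP g).
by rewrite lcoefM_lord mulf_neq0//; [case: (lordP f0)|case: (lordP g0)].
Qed.

Lemma lord1 : lord (1 : laurent F) = 0.
Proof.
by apply: lord_uniq; [exact: oner_neq0|exact: lord_ge01].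
Qed.

Lemma lordV f : f != 0 -> lord f^-1 = - lord f.
Proof.
move=> f0; apply/eqP; rewrite -addr_eq0 -lordM ?invr_eq0//.
by apply/eqP; rewrite -[RHS]lord1; congr lord; apply: mulVf.
Qed.

Lemma lord_prod I (r : seq I) (E : I -> laurent F) :
  (forall k, E k != 0) -> lord (\prod_(k <- r) E k) = \sum_(k <- r) lord (E k).
Proof.
move=> E0; elim: r => [|k r IH]; first by rewrite !big_nil lord1.
rewrite !big_cons lordM ?IH//.
by apply: (big_ind (fun f => f != 0)) => // [|f g];
  [exact: oner_neq0|exact: mulf_neq0].
Qed.

Lemma ldeg_le f n : (ldeg f <= (- n)%:E)%E <-> lord_ge n f.
Proof.
rewrite /ldeg; case: eqVneq => [->|f0]; first by rewrite leNye.
by rewrite lee_fin lerN2; split=> h; apply/(lord_ge_lord _ f0).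
Qed.

Lemma ldeg_lt f n : (ldeg f < (- n)%:E)%E <-> lord_ge (n + 1) f.
Proof.
rewrite /ldeg; case: eqVneq => [->|f0]; first by rewrite ltNye.
rewrite lte_fin ltrN2; split=> h; first by apply/(lord_ge_lord _ f0); lia.
by move/(lord_ge_lord _ f0): h; lia.
Qed.

Lemma ldegE f : f != 0 -> ldeg f = (- lord f)%:E.
Proof. by rewrite /ldeg => /negPf ->. Qed.

Lemma lcoef_lpoly p i : lcoef (lpoly p) i = if i <= 0 then p`_`|i|%N else 0.
Proof. by []. Qed.

Fact lpoly_is_zmod_morphism : zmod_morphism (@lpoly F).
Proof.
move=> p q; apply: laurentP => i; rewrite lcoefB !lcoef_lpoly coefB.
by case: ifP => // _; rewrite subrr.
Qed.

HB.instance Definition _ :=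
  GRing.isZmodMorphism.Build _ _ (@lpoly F) lpoly_is_zmod_morphism.

Lemma lpolyZ c p : lpoly (c *: p) = lmonom c 0 * lpoly p.
Proof.
apply: laurentP => i; rewrite lcoef_monomM subr0 !lcoef_lpoly coefZ.
by case: ifP => // _; rewrite mulr0.
Qed.

Lemma lpolyXM p : lpoly ('X * p) = lmonom 1 (-1) * lpoly p.
Proof.
apply: laurentP => i; rewrite lcoef_monomM mul1r !lcoef_lpoly coefXM opprK.
have [->//|i0] := eqVneq i 0.
have -> : (i + 1 <= 0) = (i <= 0) by lia.
by case: ifP => // il; rewrite absz_eq0 (negPf i0); congr (p`_ _); lia.
Qed.

Lemma lpolyC (c : F) : lpoly c%:P = lmonom c 0.
Proof.
apply: laurentP => i; rewrite lcoef_lpoly lcoef_monom coefC absz_eq0.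
by case: eqVneq => [->|]; rewrite ?mulr1n ?mulr0n//; case: ifP.
Qed.

Fact lpoly_is_monoid_morphism : monoid_morphism (@lpoly F).
Proof.
split=> [|p q].
  apply: laurentP => i; rewrite lcoef_lpoly coef1 absz_eq0.
  change ((if i <= 0 then (i == 0)%:R else 0) = (1 : F) *+ (i == 0)).
  by case: eqVneq => [->//|]; case: ifP.
elim/poly_ind: p q => [|p c IH] q; first by rewrite mul0r !raddf0 mul0r.
(* One factor ['X] passes from p to q; the induction hypothesis covers every second factor. *)
rewrite [LHS](_ : _ = lpoly (p * ('X * q)) + lpoly (c *: q)); last first.
  by rewrite mulrDl -mulrA mul_polyC raddfD.
have -> : lpoly (p * 'X + c%:P) = lpoly ('X * p) + lpoly c%:P.
  by rewrite [p * _]mulrC raddfD.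
rewrite lpolyC mulrDl IH !lpolyXM lpolyZ.
by congr (_ + _); rewrite mulrCA mulrA.
Qed.

HB.instance Definition _ :=
  GRing.isMonoidMorphism.Build _ _ (@lpoly F) lpoly_is_monoid_morphism.

Lemma lpoly_small p : lord_ge 1 (lpoly p) -> p = 0.
Proof.
move=> p1; apply/polyP => k; rewrite coef0.
have := p1 (- k%:Z); rewrite lcoef_lpoly.
have -> : (- k%:Z <= 0) by lia.
have -> : `|- k%:Z|%N = k by lia.
by apply; lia.
Qed.

(** Residue pairing: a linear form in the first N digits of f is represented by a polynomial of
    degree below N. *)
Lemma lcoef_lpolyM1 (c : nat -> F) N f :
  lcoef (lpoly (\poly_(i < N) c i) * f) 1 = \sum_(i < N) c i * lcoef f (i%:Z + 1).
Proof.
have XnM k j : lcoef (lpoly 'X^k * f) j = lcoef f (k%:Z + j).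
  elim: k j => [|k IH] j; first by rewrite expr0 rmorph1 mul1r add0r.
  by rewrite exprS lpolyXM -mulrA lcoef_monomM mul1r IH; congr lcoef; lia.
rewrite poly_def raddf_sum mulr_suml lcoef_sum; apply: eq_bigr => i _ /=.
by rewrite lpolyZ -mulrA lcoef_monomM subr0 XnM.
Qed.

(** The polynomial part. If lord f <= 0, its degree is at most -lord f; if lord f > 0, all the
    listed coefficients vanish. *)
Definition lipart f : {poly F} := \poly_(k < `|lord f|.+1) lcoef f (- k%:Z).

Lemma lipartP f : lord_ge 1 (f - lpoly (lipart f)).
Proof.
move=> i i1; rewrite lcoefB lcoef_lpoly coef_poly; have -> : i <= 0 by lia.
have iE : - `|i|%N%:Z = i by lia.
rewrite iE; case: ifP => [_|/negbT ni]; first by rewrite subrr.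
by rewrite subr0; apply: lord_geP; lia.
Qed.

Arguments lipartP f : clear implicits.

(** Two candidates differ by a polynomial of negative degree, which is 0. *)
Lemma lipart_uniq f p : lord_ge 1 (f - lpoly p) -> lipart f = p.
Proof.
move=> fp; apply/eqP; rewrite -subr_eq0; apply/eqP/lpoly_small.
have -> : lpoly (lipart f - p) = (f - lpoly p) - (f - lpoly (lipart f)).
  by rewrite raddfB/=; ring.
by apply: lord_geB fp (lipartP f).
Qed.

Fact lipart_is_zmod_morphism : zmod_morphism lipart.
Proof.
move=> f g; apply: lipart_uniq; rewrite raddfB/=.
have -> : f - g - (lpoly (lipart f) - lpoly (lipart g)) =
    (f - lpoly (lipart f)) - (g - lpoly (lipart g)).
  by ring.
exact: lord_geB (lipartP f) (lipartP g).
Qed.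

HB.instance Definition _ :=
  GRing.isZmodMorphism.Build _ _ lipart lipart_is_zmod_morphism.

End LaurentTheory.
Arguments lord_geP {F} f _ _.
Arguments lipartP {F} f _ _.

(** * Lattices modulo the unit cube *)

Section LatticeDecomposition.
Variables (F : fieldType) (d : nat).
Implicit Types (M : 'M[laurent F]_d) (r u v y : 'cV[laurent F]_d).

Lemma unit_cubeP v : unit_cube v <-> forall j, lord_ge 1 (v j 0).
Proof.
by split=> vU j; have := vU j; rewrite -[0%E]/(0 : int)%:E -[X in X%:E]oppr0;
  move/(ldeg_lt _ 0).
Qed.

Lemma unit_cubeD u v : unit_cube u -> unit_cube v -> unit_cube (u + v).
Proof.
move=> /unit_cubeP uU /unit_cubeP vU; apply/unit_cubeP => j.
by rewrite mxE; apply: lord_geD.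
Qed.

Lemma unit_cubeB u v : unit_cube u -> unit_cube v -> unit_cube (u - v).
Proof.
move=> /unit_cubeP uU /unit_cubeP vU; apply/unit_cubeP => j.
by rewrite !mxE; apply: lord_geB.
Qed.

Lemma unit_cube_mulmx M v : (forall i j, lord_ge 0 (M i j)) ->
  unit_cube v -> unit_cube (M *m v).
Proof.
move=> M0 /unit_cubeP vU; apply/unit_cubeP => j.
by rewrite mxE; apply: lord_ge_sum => k _; rewrite -[1]add0r; apply: lord_geM.
Qed.

Lemma unit_cube_lpoly (a : 'cV[{poly F}]_d) :
  unit_cube (map_mx (@lpoly F) a) -> a = 0.
Proof.
move=> /unit_cubeP aU; apply/matrixP => j k; rewrite ord1 mxE.
by apply: lpoly_small; have := aU j; rewrite mxE.
Qed.

Definition frac_part r := r - map_mx (@lpoly F) (map_mx (@lipart F) r).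

Lemma frac_partP r : unit_cube (frac_part r).
Proof. by apply/unit_cubeP => j; rewrite !mxE; apply: lipartP. Qed.

(** Each product has degree at most -2, so the unit cube U is isotropic for the residue pairing. *)
Lemma residue_dot u v : unit_cube u -> unit_cube v ->
  lcoef (\sum_j u j 0 * v j 0) 1 = 0.
Proof.
move=> /unit_cubeP uU /unit_cubeP vU.
suff: lord_ge 2 (\sum_j u j 0 * v j 0) by apply.
by apply: lord_ge_sum => j _; apply: (@lord_geM _ 1 1).
Qed.

(** The projection onto M A^d along M U; for invertible M these are complementary subgroups of
    K^d. *)
Definition lattice_part M r :=
  M *m map_mx (@lpoly F) (map_mx (@lipart F) (invmx M *m r)).

Fact lattice_part_is_zmod_morphism M : zmod_morphism (lattice_part M).
Proof.
by move=> r u; rewrite /lattice_part mulmxBr map_mxB map_mxB mulmxBr.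
Qed.
HB.instance Definition _ M := GRing.isZmodMorphism.Build _ _
  (lattice_part M) (lattice_part_is_zmod_morphism M).

Lemma lattice_part_lattice M r : lattice M (lattice_part M r).
Proof. by exists (map_mx (@lipart F) (invmx M *m r)). Qed.

Lemma lattice_partE M r : M \in unitmx ->
  r = lattice_part M r + M *m frac_part (invmx M *m r).
Proof. by move=> Mu; rewrite -mulmxDr addrC subrK mulKVmx. Qed.

Lemma lattice_part_uniq M r g v : M \in unitmx ->
  lattice M g -> unit_cube v -> r = g + M *m v -> lattice_part M r = g.
Proof.
move=> Mu [a _ <-] /unit_cubeP vU ->; congr (_ *m _).
rewrite -mulmxDr mulKmx//; congr map_mx; apply/matrixP => j k.
rewrite ord1 !mxE; apply: lipart_uniq.
by rewrite [X in lord_ge _ X](_ : _ = v j 0) ?(vU j)//; ring.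
Qed.

Lemma lattice_part_unit_cube M r : M \in unitmx ->
  (forall i j, lord_ge 0 (M i j)) -> unit_cube r ->
  unit_cube (lattice_part M r).
Proof.
move=> Mu M0 rU; have /eqP := lattice_partE r Mu.
rewrite -subr_eq => /eqP <-; apply: unit_cubeB => //.
exact/unit_cube_mulmx/frac_partP.
Qed.

Lemma dotE (R : comNzRingType) (x z : 'cV[R]_d) :
  \sum_j x j 0 * z j 0 = (x^T *m z) 0 0.
Proof. by rewrite mxE; apply: eq_bigr => j _; rewrite mxE. Qed.

(* This is the inclusion of the annihilator of M A^d `&` U in M^-T A^d + U, for
   the residue pairing.  Writing M^T q = a + v with a polynomial and v in U, take
   y = M^-T a. *)
Lemma dual_approximation M (q : 'cV[{poly F}]_d) : M \in unitmx ->
  (forall r, unit_cube r ->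
     lcoef (\sum_j lpoly (q j 0) * lattice_part M r j 0) 1 = 0) ->
  exists2 y, dual_lattice (lattice M) y & unit_cube (map_mx (@lpoly F) q - y).
Proof.
move=> Mu q0; pose q' := map_mx (@lpoly F) q.
pose a := map_mx (@lipart F) (M^T *m q').
pose y := (invmx M)^T *m map_mx (@lpoly F) a.
have yX : dual_lattice (lattice M) y.
  move=> _ [c _ <-]; exists ((a^T *m c) 0 0) => //.
  rewrite dotE /y trmx_mul trmxK -!mulmxA (mulmxA (invmx M)) mulVmx// mul1mx.
  by rewrite (map_trmx (@lpoly F)) -map_mxM [RHS]mxE.
exists y => //; pose z := q' - y.
have zE : M^T *m z = frac_part (M^T *m q').
  rewrite mulmxBr /frac_part; congr (_ - _).
  by rewrite mulmxA -trmx_mul mulVmx// trmx1 mul1mx.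
apply/unit_cubeP => k i i1.
(* The test vector x^(i-1) e_k lies in U since i < 1, and its residue pairing with z is the
   coefficient of x^-i in z_k. *)
pose u : 'cV[laurent F]_d := \col_j if j == k then lmonom 1 (1 - i) else 0.
have uE j : u j 0 = if j == k then lmonom 1 (1 - i) else 0 by rewrite mxE.
have uU : unit_cube u.
  apply/unit_cubeP => j; rewrite uE; case: eqP => // _ l l1.
  by rewrite lcoef_monom; case: eqP l1 => // ->; lia.
have -> : lcoef (z k 0) i = lcoef (\sum_j u j 0 * z j 0) 1.
  rewrite (bigD1 k)//= big1 ?addr0; last first.
    by move=> j /negPf jk; rewrite uE jk mul0r.
  by rewrite uE eqxx lcoef_monomM mul1r; congr lcoef; lia.
(* Moving M across, the second summand pairs an element of U with M^T z, again in U. On the first,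
   the residue with q is 0 by hypothesis, and y pairs to a polynomial. *)
have uT : u^T = (lattice_part M u)^T + (frac_part (invmx M *m u))^T *m M^T.
  by rewrite -trmx_mul -[in LHS](esym (lattice_partE u Mu)) linearD.
rewrite dotE uT mulmxDl mxE -mulmxA zE -!dotE lcoefD.
rewrite [X in _ + X]residue_dot ?addr0; [|exact: frac_partP..].
rewrite [X in lcoef X](_ : _ = \sum_j lpoly (q j 0) * lattice_part M u j 0 -
   \sum_j y j 0 * lattice_part M u j 0); last first.
  by rewrite -sumrB; apply: eq_bigr => j _; rewrite !mxE mulrC mulrBl.
rewrite lcoefB q0// sub0r.
by have [p _ <-] := yX _ (lattice_part_lattice M u); rewrite lcoef_lpoly oppr0.
Qed.

End LatticeDecomposition.

(** * Triangular division *)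

Section TriangularDivision.
Variables (F : fieldType) (d : nat) (L : 'M[laurent F]_d) (n : 'I_d -> nat).
Hypothesis L_trig : is_trig_mx L.
Hypothesis L_int : forall i j, lord_ge 0 (L i j).
Hypothesis L_diag : forall j, L j j != 0.
Hypothesis L_lord : forall j, lord (L j j) = n j.
Implicit Types (u v r : 'cV[laurent F]_d).

Fact ltrunc_subproof (k : nat) (f : laurent F) :
  lbounded (fun i => if i <= k%:Z then lcoef f i else 0).
Proof. by have [w fw] := lcoefP f; exists w => i /fw ->; case: ifP. Qed.
Definition ltrunc k f := Laurent (ltrunc_subproof k f).

Lemma lcoef_ltrunc k f i :
  lcoef (ltrunc k f) i = if i <= k%:Z then lcoef f i else 0.
Proof. by []. Qed.

Definition short_digits r := forall j (i : int), (n j)%:Z < i -> lcoef (r j 0) i = 0.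

(** Forward substitution: as L is lower triangular, changing entry k of v leaves the coordinates
    before k untouched. *)
Lemma trig_division u : unit_cube u ->
  exists2 v, unit_cube v & short_digits (u - L *m v).
Proof.
move=> uU.
suff: forall k, (k <= d)%N -> exists2 v, unit_cube v &
    forall (j : 'I_d) (i : int), (j < k)%N -> (n j)%:Z < i ->
      lcoef ((u - L *m v) j 0) i = 0.
  by move=> /(_ d (leqnn d))[v vU uv]; exists v => // j i; apply: uv.
elim=> [_|k IH kd]; first by exists 0 => //; apply/unit_cubeP => j; rewrite mxE.
have [v vU uv] := IH (ltnW kd); pose k' := Ordinal kd.
pose w := (u - L *m v) k' 0.
have w1 : lord_ge 1 w.
  have /unit_cubeP wU := unit_cubeB uU (unit_cube_mulmx L_int vU).
  exact: wU.
(* Cancels the digits of w beyond position [n k']. That tail has order at least [n k' + 1], so e has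
   negative degree. *)
pose e := (L k' k')^-1 * (w - ltrunc (n k') w).
have e1 : lord_ge 1 e.
  rewrite (_ : 1 = - (n k')%:Z + ((n k')%:Z + 1)); last by lia.
  apply: lord_geM; first by rewrite -L_lord -lordV//; apply: lord_geP.
  move=> i ink; rewrite lcoefB lcoef_ltrunc.
  by rewrite ifT ?subrr//; lia.
exists (v + e *: delta_mx k' 0).
  apply: unit_cubeD => //; apply/unit_cubeP => j; rewrite !mxE andbT.
  by case: eqP => _; rewrite ?mulr1// mulr0.
move=> j i jk ij; rewrite mulmxDr opprD addrA -scalemxAr -colE.
have -> : (u - L *m v - e *: col k' L) j 0 = (u - L *m v) j 0 - L j k' * e.
  by rewrite !mxE [e * _]mulrC.
move: jk; rewrite ltnS leq_eqVlt => /predU1P[jk|jk].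
  have jE : j = k' by apply: val_inj.
  rewrite jE -/w mulrA mulfV// mul1r subKr lcoef_ltrunc ifF//.
  by move: ij; rewrite jE; lia.
have -> : L j k' = 0 by move/is_trig_mxP: L_trig; apply.
by rewrite mul0r subr0; apply: uv.
Qed.

(** By strong induction coordinate j of L v is L_jj v_j. If v_j were nonzero, the leading digit of
    this product would sit at n_j + lord v_j > n_j, where a short expansion has none. *)
Lemma trig_division_uniq v : unit_cube v -> short_digits (L *m v) -> v = 0.
Proof.
move=> /unit_cubeP vU Lv; apply/matrixP => j0 k; rewrite ord1 mxE {k}.
have [m] := ubnP (nat_of_ord j0); elim: m j0 => // m IH j jm.
have LvE : (L *m v) j 0 = L j j * v j 0.
  rewrite mxE (bigD1 j)//= big1 ?addr0// => k kj.
  have [jk|kj'] := ltnP j k.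
    by move/is_trig_mxP: L_trig => ->//; rewrite mul0r.
  rewrite IH ?mulr0//; have : nat_of_ord k != j by [].
  by move: kj' jm; lia.
apply/eqP/negPn/negP => v0; have Lv0 : L j j * v j 0 != 0 by rewrite mulf_neq0.
have [+ _] := lordP Lv0; rewrite -LvE Lv ?eqxx// LvE lordM// L_lord.
by move/(lord_ge_lord _ v0): (vU j); lia.
Qed.

End TriangularDivision.

(** * Digit maps *)

Section Digits.
Variables (F : fieldType) (d : nat) (l : 'I_d -> nat).
Implicit Types g h : 'cV[laurent F]_d.

Local Notation digit_index := {j : 'I_d & 'I_(l j)}.

(** Enumerating the pairs (coordinate, digit) turns the chosen digits into one row vector, so that
    linear algebra applies. Digit i counts from 0 and is the coefficient of x^-(i+1). *)
Definition digit_pos (k : 'I_#|{: digit_index}|) : digit_index := enum_val k.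

Lemma card_digit_index : #|{: digit_index}| = (\sum_j l j)%N.
Proof.
rewrite card_tagged sumnE big_map -big_enum/=.
by apply: eq_bigr => j _; rewrite card_ord.
Qed.

Definition digits g : 'rV[F]_#|{: digit_index}| :=
  \row_k lcoef (g (tag (digit_pos k)) 0) ((tagged (digit_pos k)).+1)%:Z.

Definition of_digits (w : 'rV[F]_#|{: digit_index}|) : 'cV[laurent F]_d :=
  \col_j \sum_(i < l j)
    lmonom (w 0 (enum_rank (Tagged (fun j => 'I_(l j)) i))) (i.+1)%:Z.

Lemma lcoef_of_digits w j i :
  lcoef (of_digits w j 0) i = \sum_(k < l j)
    w 0 (enum_rank (Tagged (fun j => 'I_(l j)) k)) *+ (i == (k.+1)%:Z).
Proof. by rewrite mxE lcoef_sum. Qed.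

Lemma lcoef_of_digitsS w j (k : 'I_(l j)) :
  lcoef (of_digits w j 0) (k.+1)%:Z =
  w 0 (enum_rank (Tagged (fun j => 'I_(l j)) k)).
Proof.
rewrite lcoef_of_digits (bigD1 k)//= eqxx mulr1n big1 ?addr0// => i ik.
by case: eqP => // -[] e; rewrite (_ : i = k) ?eqxx// in ik; apply: val_inj.
Qed.

Lemma of_digits_unit_cube w : unit_cube (of_digits w).
Proof.
apply/unit_cubeP => j i i1; rewrite lcoef_of_digits big1// => k _.
by case: eqP => //; lia.
Qed.

Lemma of_digits_short w : short_digits l (of_digits w).
Proof.
move=> j i li; rewrite lcoef_of_digits big1// => k _.
by case: eqP => //; have := ltn_ord k; lia.
Qed.

Fact digits_is_zmod_morphism : zmod_morphism digits.
Proof. by move=> g h; apply/rowP => k; rewrite !mxE lcoefB. Qed.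
HB.instance Definition _ :=
  GRing.isZmodMorphism.Build _ _ digits digits_is_zmod_morphism.

Fact of_digits_is_zmod_morphism : zmod_morphism of_digits.
Proof.
move=> v w; apply/matrixP => j k; rewrite ord1 {k}; apply: laurentP => i.
rewrite !mxE lcoefB !lcoef_sum -sumrB; apply: eq_bigr => k _.
by rewrite !lcoef_monom !mxE mulrnBl.
Qed.
HB.instance Definition _ :=
  GRing.isZmodMorphism.Build _ _ of_digits of_digits_is_zmod_morphism.

(** Coefficients before x^-1 vanish on both sides. This identifies the elementary intervals of
    [is_net] with fibres of [digits]. *)
Lemma digits_eqP g h : unit_cube g -> unit_cube h ->
  digits g = digits h <->
  (forall j, lord_ge ((l j)%:Z + 1) (g j 0 - h j 0)).
Proof.
move=> /unit_cubeP gU /unit_cubeP hU; split=> [gh j i il|gh].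
  have [i1|i1] := ltP i 1; first by rewrite lcoefB gU// hU// subrr.
  have kl : (`|i|.-1 < l j)%N by lia.
  have /rowP/(_ (enum_rank (Tagged (fun j => 'I_(l j)) (Ordinal kl)))) := gh.
  rewrite !mxE /digit_pos enum_rankK/= => e; rewrite lcoefB.
  have iE : i = (`|i|.-1.+1)%:Z by lia.
  by rewrite [in LHS]iE e subrr.
apply/rowP => k; rewrite !mxE; apply/eqP; rewrite -subr_eq0 -lcoefB.
by rewrite gh//; have := ltn_ord (tagged (digit_pos k)); lia.
Qed.

Lemma of_digitsK w : digits (of_digits w) = w.
Proof.
apply/rowP => k; rewrite mxE lcoef_of_digitsS; congr (w _ _).
by rewrite -[RHS]enum_valK -/(digit_pos k); congr enum_rank; case: (digit_pos k).
Qed.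

Lemma digitsK g : unit_cube g -> short_digits l g -> of_digits (digits g) = g.
Proof.
move=> gU gl; have /digits_eqP := of_digitsK (digits g).
move=> /(_ (of_digits_unit_cube _) gU) e.
apply/matrixP => j k; rewrite ord1; apply/eqP; rewrite -subr_eq0; apply/eqP.
apply: laurentP => i; have [il|il] := ltP i ((l j)%:Z + 1); first exact: e.
by rewrite lcoefB gl ?of_digits_short ?subrr//; lia.
Qed.

End Digits.

(** The fibres of an onto additive map are translates of one another. *)
Lemma card_fiber (A B : finZmodType) (f : {additive A -> B}) (v : B) :
  (forall u, exists w, f w = u) ->
  #|A| = (#|B| * #|[set w | f w == v]%SET|)%N.
Proof.
move=> f_onto.
transitivity (\sum_(u : B) #|[set w | f w == u]%SET|)%N.
  rewrite -sum1_card (partition_big f xpredT)//=; apply: eq_bigr => u _.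
  by rewrite -sum1_card; apply: eq_bigl => w; rewrite inE.
rewrite -sum_nat_const; apply: eq_bigr => u _.
have [a fa] := f_onto (v - u).
rewrite -(card_imset _ (@addIr _ a)); apply: eq_card => w; rewrite inE.
apply/imsetP/eqP => [[x]|fw].
  by rewrite inE => /eqP fx ->; rewrite raddfD/= fx fa addrC subrK.
by exists (w - a); rewrite ?subrK// inE raddfB/= fw fa subKr.
Qed.

(** * Lattice points in elementary intervals *)

(** A proper subspace of row vectors is killed by a nonzero column. Additivity implies linearity
    because every scalar of ['F_b] is a multiple of 1. *)
Lemma additive_onto (b m k : nat) (f : {additive 'rV['F_b]_m -> 'rV['F_b]_k}) :
  (forall q : 'cV_k, (forall w, f w *m q = 0) -> q = 0) ->
  forall v, exists w, f w = v.
Proof.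
move=> f_ann v; pose A := \matrix_i f (delta_mx 0 i).
have fE w : f w = w *m A.
  rewrite [in LHS](row_sum_delta w) raddf_sum mulmx_sum_row /=.
  apply: eq_bigr => i _; rewrite rowK -[w 0 i]natr_Zp !scaler_nat.
  by rewrite raddfMn.
have /eqP : cokermx A = 0.
  apply/matrixP => i j; rewrite mxE.
  have /colP/(_ i) : col j (cokermx A) = 0.
    by apply: f_ann => w; rewrite fE colE -mulmxA (mulmxA A) mulmx_coker;
      rewrite mul0mx mulmx0.
  by rewrite !mxE.
rewrite cokermx_eq0 => A_full; have /submxP[w ->] := submx_full v A_full.
by exists w; rewrite fE.
Qed.

(** When det Q = 1 the adjugate is the inverse, so its integrality gives Q U = U. *)
Lemma lord_ge_adj (F : fieldType) (d : nat) (Q : 'M[laurent F]_d) :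
  (forall i j, lord_ge 0 (Q i j)) -> forall i j, lord_ge 0 ((\adj Q) i j).
Proof.
have sgn (c : nat) : lord_ge 0 ((-1) ^+ c : laurent F).
  rewrite -signr_odd; case: (odd c); rewrite ?expr1 ?expr0.
    by apply/lord_geN/lord_ge01.
  exact: lord_ge01.
move=> Q0 i j; rewrite mxE -[0]addr0; apply: lord_geM => //.
apply: lord_ge_sum => s _; rewrite -[0]addr0; apply: lord_geM => //.
by apply: lord_ge_prod => k _; rewrite !mxE.
Qed.

Section LatticePoints.
Variables (b d : nat) (L Q : 'M[laurent 'F_b]_d) (n : 'I_d -> nat).
Hypothesis b_prime : prime b.
Hypothesis L_trig : is_trig_mx L.
Hypothesis L_int : forall i j, lord_ge 0 (L i j).
Hypothesis L_diag : forall j, L j j != 0.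
Hypothesis L_lord : forall j, lord (L j j) = n j.
Hypothesis Q_int : forall i j, lord_ge 0 (Q i j).
Hypothesis Q_det : \det Q = 1.

Let M := L *m Q.
Let P := lattice M `&` @unit_cube _ d.
(** Short expansions and P are both complements of M U in U; projecting along M U is the bijection
    between them. *)
Let point w := lattice_part M (of_digits (l := n) w).

Lemma LQ_unitmx : M \in unitmx.
Proof.
rewrite unitmxE det_mulmx Q_det mulr1 (det_trig L_trig) unitfE.
by apply/prodf_neq0 => j _.
Qed.

Lemma LQ_int i j : lord_ge 0 (M i j).
Proof.
by rewrite mxE; apply: lord_ge_sum => k _; rewrite -[0]addr0; apply: lord_geM.
Qed.

Lemma pointP w : P (point w).
Proof.
split; first exact: lattice_part_lattice.
exact: (lattice_part_unit_cube LQ_unitmx LQ_int (@of_digits_unit_cube _ _ _ w)).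
Qed.

(** Reducing g modulo L U gives a short representative. As L v = M (Q^-1 v) lies in M U, projecting
    that representative returns g. *)
Lemma point_onto g : P g -> exists w, point w = g.
Proof.
move=> [Xg gU].
have [v vU gv] := trig_division L_trig L_int L_diag L_lord gU.
have rU := unit_cubeB gU (unit_cube_mulmx L_int vU).
exists (digits n (g - L *m v)); rewrite /point digitsK//.
apply: (lattice_part_uniq (v := - (\adj Q *m v)) LQ_unitmx Xg).
  rewrite -mulmxN; apply: unit_cube_mulmx; first exact: lord_ge_adj.
  rewrite -[- v]sub0r; apply: unit_cubeB => //.
  by apply/unit_cubeP => j; rewrite mxE.
by rewrite mulmxN /M -mulmxA [Q *m _]mulmxA mul_mx_adj Q_det mul1mx.
Qed.

(** A kernel element is a short expansion in M U, hence in L U, so [trig_division_uniq] applies. *)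
Lemma point_inj : injective point.
Proof.
suff point0 w : point w = 0 -> w = 0.
  move=> v w vw; apply/eqP; rewrite -subr_eq0; apply/eqP/point0.
  by rewrite /point !raddfB/= -!/(point _) vw subrr.
move=> w0; rewrite -[w]of_digitsK.
have := lattice_partE (of_digits w) LQ_unitmx.
rewrite -/(point w) w0 add0r /M -mulmxA.
set v := Q *m _ => wE.
have vU : unit_cube v := unit_cube_mulmx Q_int (frac_partP _).
have v0 : v = 0.
  apply: (trig_division_uniq L_trig L_diag L_lord vU).
  by rewrite -wE; apply: of_digits_short.
by rewrite wE v0 mulmx0 raddf0.
Qed.

Lemma card_point_image (S : {set 'rV['F_b]_#|{: {j : 'I_d & 'I_(n j)}}|}) :
  (point @` [set` S] #= `I_#|S|)%card.
Proof.
apply: card_eq_trans (inj_card_eq (in2W point_inj)) _.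
have -> : [set` S] = [set` [fset w in S]%fset].
  by apply/seteqP; split=> w /=; rewrite !inE.
by apply/card_eq_fsetP; rewrite card_finset.
Qed.

Lemma card_rV_digits (l : 'I_d -> nat) :
  #|{: 'rV['F_b]_#|{: {j : 'I_d & 'I_(l j)}}|}| = (b ^ \sum_j l j)%N.
Proof. by rewrite card_mx card_Fp// mul1n card_digit_index. Qed.

Lemma card_lattice_points : (P #= `I_(b ^ \sum_j n j))%card.
Proof.
have <- : point @` [set` finset.setT] = P.
  apply/seteqP; split=> [_ [w _ <-]|g /point_onto[w <-]]; first exact: pointP.
  by exists w => //=; rewrite inE.
have <- : #|(finset.setT : {set 'rV['F_b]_#|{: {j : 'I_d & 'I_(n j)}}|})| =
    (b ^ \sum_j n j)%N by rewrite cardsT card_rV_digits.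
exact: card_point_image.
Qed.

Section Cylinders.
Variable l : 'I_d -> nat.
Hypothesis dual_min : forall y, dual_lattice (lattice M) y ->
  (forall j, lord_ge (1 - (l j)%:Z) (y j 0)) -> y = 0.

(** The coefficients of a linear form vanishing on all digit vectors form polynomials p_j of degree
    below l_j. A dual vector y congruent to p modulo U obeys the same bounds, so y = 0, and then p
    lies in U. *)
Lemma digits_onto v : exists w, digits l (point w) = v.
Proof.
apply: (@additive_onto _ _ _ (digits l \o lattice_part M \o of_digits (l:=n))).
move=> q qP.
pose c (j : 'I_d) (i : nat) : 'F_b :=
  if (insub i : option 'I_(l j)) is Some i' then
  q (enum_rank (Tagged (fun j => 'I_(l j)) i')) 0 else 0.
have cE (j : 'I_d) (i : 'I_(l j)) :
    c j i = q (enum_rank (Tagged (fun j => 'I_(l j)) i)) 0.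
  by rewrite /c valK.
pose p : 'cV_d := \col_j \poly_(i < l j) c j i.
suff p0 : p = 0.
  apply/colP => k; rewrite mxE -[k]enum_valK; case: (enum_val k) => j i.
  have /matrixP/(_ j 0)/polyP/(_ i) := p0.
  by rewrite !mxE coef_poly ltn_ord cE coef0.
have [] := @dual_approximation _ _ M p LQ_unitmx.
  move=> r rU; have [w <-] := point_onto (conj (lattice_part_lattice M r)
    (lattice_part_unit_cube LQ_unitmx LQ_int rU)).
  have /matrixP/(_ 0 0) := qP w; rewrite [RHS]mxE [LHS]mxE => <-.
  transitivity (\sum_j \sum_(i < l j) c j i * lcoef (point w j 0) (i.+1)%:Z).
    rewrite lcoef_sum; apply: eq_bigr => j _; rewrite mxE lcoef_lpolyM1.
    by apply: eq_bigr => i _; congr (_ * lcoef _ _); lia.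
  rewrite sig_big_dep [RHS](reindex (@enum_rank {: {j : 'I_d & 'I_(l j)}}))/=.
    apply: eq_bigr => -[j i] _; rewrite /= cE mulrC; congr (_ * _).
    by rewrite [RHS]mxE /digit_pos enum_rankK.
  by exists enum_val => k _; rewrite ?enum_rankK ?enum_valK.
move=> y yX pyU; have y0 : y = 0; last first.
  by rewrite y0 subr0 in pyU; apply: unit_cube_lpoly.
apply: dual_min => // j; have /unit_cubeP/(_ j) := pyU.
rewrite mxE [X in X + _]mxE [X in _ + X]mxE => pyj.
have -> : y j 0 = lpoly (p j 0) - (lpoly (p j 0) - y j 0) by rewrite subKr.
apply: lord_geB; last by apply: lord_ge_le pyj; lia.
move=> i il; rewrite lcoef_lpoly; case: ifP => // i0.
by rewrite mxE nth_default// (leq_trans (size_poly _ _))//; lia.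
Qed.

(** The equation for k also records \sum l_j <= \sum n_j, which follows from divisibility of the
    orders of the two digit groups. *)
Lemma card_cylinder v :
  exists2 k, (\sum_j n j = k + \sum_j l j)%N &
  (P `&` [set g | digits l g = v] #= `I_(b ^ k))%card.
Proof.
pose S := [set w | digits l (point w) == v]%SET.
have := card_fiber (f := digits l \o lattice_part M \o of_digits (l:=n)) v
  digits_onto.
rewrite -/S !card_rV_digits => bS.
have b1 := prime_gt1 b_prime.
have ln : (\sum_j l j <= \sum_j n j)%N.
  by rewrite -(@dvdn_Pexp2l b)// bS dvdn_mulr.
exists (\sum_j n j - \sum_j l j)%N; first by rewrite subnK.
have <- : point @` [set` S] = P `&` [set g | digits l g = v].
  apply/seteqP; split=> [_ [w + <-]|g [/point_onto[w <-] wv]].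
    by rewrite /= inE => /eqP wv; split => //; apply: pointP.
  by exists w => //=; rewrite inE; apply/eqP.
suff <- : #|S| = (b ^ (\sum_j n j - \sum_j l j))%N by apply: card_point_image.
apply/eqP; rewrite -(@eqn_pmul2l (b ^ \sum_j l j)) ?expn_gt0 ?prime_gt0//.
by rewrite -expnD subnKC// -bS.
Qed.

End Cylinders.

End LatticePoints.

(** * Discrepancy of nets *)

Section DigitPieces.
Variables (b n : nat).
Hypothesis b_gt1 : (1 < b)%N.

(* [0, Y) is cut, for each k, into the at most b - 1 intervals
   [a b^k, (a + 1) b^k) with floor(Y / b^{k+1}) b <= a < floor(Y / b^k). *)
Definition piece_index Y (x : 'I_n.+1 * 'I_b) : nat :=
  Y %/ b ^ x.1.+1 * b + x.2.

Definition piece_proper Y (x : 'I_n.+1 * 'I_b) : bool :=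
  (piece_index Y x < Y %/ b ^ x.1)%N.

Definition in_piece Y x g : bool :=
  piece_proper Y x && (g %/ b ^ x.1 == piece_index Y x)%N.

(** The pieces partition [0, Y), by telescoping over the levels. *)
Lemma sum_in_piece Y g : (Y <= b ^ n)%N ->
  (\sum_x in_piece Y x g = (g < Y))%N.
Proof.
move=> Yn; have b_gt0 : (0 < b)%N by apply: ltnW.
(* If g / b^k is below Y / b^k, then either the quotient of g at level k + 1 is already smaller, or
   the two agree there and g lies in exactly one piece of level k. *)
have level k : (\sum_(c < b) ((Y %/ b ^ k.+1 * b + c < Y %/ b ^ k) &&
     (g %/ b ^ k == Y %/ b ^ k.+1 * b + c)) + (g %/ b ^ k.+1 < Y %/ b ^ k.+1)
   = (g %/ b ^ k < Y %/ b ^ k))%N.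
  rewrite expnSr !divnMA; move: (g %/ _)%N (Y %/ _)%N => h y.
  have [hy|yh|hy] := ltngtP (h %/ b) (y %/ b).
  - rewrite big1 ?add0n => [|c _]; last first.
      by apply/eqP; rewrite eqb0; apply/negP => /andP[_ /eqP hE]; move: hy;
        rewrite hE divnMDl// (divn_small (ltn_ord c)) addn0 ltnn.
    by symmetry; apply/eqP; rewrite eqb1; apply: contraTT hy;
      rewrite -!leqNgt => /leq_div2r->.
  - rewrite big1 ?addn0 => [|c _]; last first.
      by apply/eqP; rewrite eqb0; apply/negP => /andP[_ /eqP hE]; move: yh;
        rewrite hE divnMDl// (divn_small (ltn_ord c)) addn0 ltnn.
    by symmetry; apply/eqP; rewrite eqb0 -leqNgt; apply: contraTT yh;
      rewrite -ltnNge -leqNgt => /ltnW/leq_div2r->.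
  rewrite addn0 (bigD1 (Ordinal (ltn_pmod h b_gt0)))//= -hy -divn_eq eqxx andbT.
  rewrite big1 ?addn0// => c hc; apply/eqP; rewrite eqb0.
  apply: contra hc => /andP[_ /eqP hE]; apply/eqP/val_inj => /=.
  by rewrite hE modnMDl modn_small.
have partial m : (\sum_(k < m) \sum_(c < b) ((Y %/ b ^ k.+1 * b + c < Y %/ b ^ k) &&
     (g %/ b ^ k == Y %/ b ^ k.+1 * b + c)) + (g %/ b ^ m < Y %/ b ^ m)
     = (g < Y))%N.
  elim: m => [|m IH]; first by rewrite big_ord0 expn0 !divn1.
  by rewrite big_ord_recr/= -addnA level.
(* Level n is present because Y = b^n is allowed; at level n + 1 the quotient of Y is 0. *)
have := partial n.+1; rewrite [in (_ %/ _ < _)%N](@divn_small Y) ?addn0.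
  by rewrite pair_big.
by rewrite (leq_ltn_trans Yn)// ltn_exp2l.
Qed.

(** Level k has as many proper pieces as digit k of Y in base b, so the lengths add up to the
    expansion of Y. *)
Lemma sum_piece_volume Y : (Y <= b ^ n)%N ->
  (\sum_x piece_proper Y x * b ^ (x : 'I_n.+1 * 'I_b).1 = Y)%N.
Proof.
move=> Yn; have b_gt0 : (0 < b)%N by apply: ltnW.
have count_lt z r : (r <= b)%N -> (\sum_(c < b) (z + c < z + r) = r)%N.
  move=> rb; transitivity (\sum_(c < b | (c < r)%N) 1)%N.
    by rewrite [RHS]big_mkcond; apply: eq_bigr => c _; rewrite ltn_add2l; case: ifP.
  by rewrite (big_ord_narrow rb) sum_nat_const card_ord muln1.
have partial m : (\sum_(k < m) (\sum_(c < b)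
     (Y %/ b ^ k.+1 * b + c < Y %/ b ^ k)) * b ^ k + Y %/ b ^ m * b ^ m = Y)%N.
  elim: m => [|m IH]; first by rewrite big_ord0 expn0 divn1 muln1.
  rewrite big_ord_recr/= -[RHS]IH -addnA; congr addn.
  rewrite [in LHS]expnSr divnMA {2}(divn_eq (Y %/ b ^ m) b) count_lt; last first.
    by rewrite ltnW// ltn_pmod.
  by rewrite [in RHS](divn_eq (Y %/ b ^ m) b); lia.
have := partial n.+1; rewrite (@divn_small Y (b ^ n.+1)) ?mul0n ?addn0.
  move=> YE; rewrite -[RHS]YE.
  transitivity (\sum_(k < n.+1) \sum_(c < b) piece_proper Y (k, c) * b ^ k)%N.
    by rewrite pair_bigA; apply: eq_bigr => -[].
  by apply: eq_bigr => k _; rewrite big_distrl.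
by rewrite (leq_ltn_trans Yn)// ltn_exp2l.
Qed.

Lemma piece_index_lt Y x : (Y <= b ^ n)%N -> piece_proper Y x ->
  (piece_index Y x < b ^ (n - x.1))%N.
Proof.
move=> Yn /leq_trans; apply.
have -> : (b ^ (n - x.1) = b ^ n %/ b ^ x.1)%N.
  by rewrite expnB ?(ltnW b_gt1)// -ltnS ltn_ord.
exact: leq_div2r.
Qed.

End DigitPieces.

(** Serves to coarsen an elementary interval that is too fine; positive entries are lowered one at a
    time. *)
Lemma sum_truncate (I : finType) (l : I -> nat) n : (n <= \sum_i l i)%N ->
  exists2 l' : I -> nat, (forall i, l' i <= l i)%N & (\sum_i l' i = n)%N.
Proof.
move: {2}(\sum_i l i - n)%N (leqnn (\sum_i l i - n)) => m.
elim: m l => [|m IH] l lm nl; first by exists l => //; lia.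
have [/eqP ln|ln] := boolP (\sum_i l i == n)%N; first by exists l.
have /existsP[i li] : [exists i, (0 < l i)%N].
  apply: contraNT ln => /existsPn l0; have : (\sum_i l i = 0)%N.
    by apply: big1 => i _; have := l0 i; lia.
  by lia.
pose l1 j := if j == i then (l i).-1 else l j.
have l1E : (\sum_j l j = (\sum_j l1 j).+1)%N.
  rewrite (bigD1 i)//= [in RHS](bigD1 i)//= /l1 eqxx -addSn prednK//.
  by congr addn; apply: eq_bigr => j /negPf ->.
have [|| l' l'l l'n] := IH l1; [lia|lia|].
exists l' => // j; apply: leq_trans (l'l j) _; rewrite /l1.
by case: eqP => // ->; apply: leq_pred.
Qed.

(** * Counting points of a net in boxes with n-digit corners *)

Section NetBoxes.
Variables (R : realFieldType) (b e n t : nat) (I : Type) (s : seq I).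
(** Stands for the integer formed by the first n digits of coordinate j, so that elementary
    intervals become conditions on quotients by powers of b. *)
Variable G : 'I_e.+1 -> I -> nat.
Hypothesis b_gt1 : (1 < b)%N.
Hypothesis G_lt : forall j p, (G j p < b ^ n)%N.
Hypothesis G_net : forall l a : 'I_e.+1 -> nat, (\sum_j l j)%N = n ->
  (forall j, (a j < b ^ l j)%N) ->
  count (fun p => [forall j, G j p %/ b ^ (n - l j) == a j]%N) s = (b ^ t)%N.

Let b_gt0 : (0 < b)%N. Proof. exact: ltnW. Qed.

Lemma count_sum (T : Type) (r : seq T) (Q : pred T) :
  count Q r = (\sum_(p <- r) Q p)%N.
Proof. by elim: r => [|x r IH]; rewrite ?big_nil// big_cons /= IH. Qed.

Definition cons_fun (x : nat) (f : 'I_e -> nat) (j : 'I_e.+1) : nat :=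
  if unlift ord0 j is Some i then f i else x.

Lemma cons_fun0 x f : cons_fun x f ord0 = x.
Proof. by rewrite /cons_fun unlift_none. Qed.

Lemma cons_funS x f i : cons_fun x f (lift ord0 i) = f i.
Proof. by rewrite /cons_fun liftK. Qed.

Lemma sum_cons_fun x f : (\sum_j cons_fun x f j = x + \sum_i f i)%N.
Proof.
rewrite big_ord_recl cons_fun0; congr addn.
by apply: eq_bigr => i _; rewrite cons_funS.
Qed.

Lemma forall_ord_recl (Q : pred 'I_e.+1) :
  [forall j, Q j] = Q ord0 && [forall i : 'I_e, Q (lift ord0 i)].
Proof.
apply/forallP/andP => [h|[h0 /forallP h] j]; first by split => //; apply/forallP.
by case: (unliftP ord0 j) => [i|] ->.
Qed.

(** Coordinate 0 receives the resolution n - \sum l_i left over by the others, which explains the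
    divisor b^(\sum l_i). *)
Lemma net_slice (l a : 'I_e -> nat) (A : nat) :
  (\sum_i l i <= n)%N -> (forall i, a i < b ^ l i)%N ->
  (A < b ^ (n - \sum_i l i))%N ->
  count (fun p => (G ord0 p %/ b ^ (\sum_i l i) == A) &&
    [forall i, G (lift ord0 i) p %/ b ^ (n - l i) == a i])%N s = (b ^ t)%N.
Proof.
move=> ln al Al.
rewrite -(@G_net (cons_fun (n - \sum_i l i) l) (cons_fun A a)).
- apply: eq_count => p; rewrite forall_ord_recl !cons_fun0 subKn//; congr andb.
  by apply: eq_forallb => i; rewrite !cons_funS.
- by rewrite sum_cons_fun subnK.
- by move=> j; case: (unliftP ord0 j) => [i|] ->; rewrite ?cons_funS ?cons_fun0.
Qed.

(** Slices are stacked along coordinate 0. Those past the end of the range are empty, so only the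
    upper bound survives there. *)
Lemma net_slab (l a : 'I_e -> nat) (A : nat) :
  (\sum_i l i <= n)%N -> (forall i, a i < b ^ l i)%N ->
  let c := count (fun p => (G ord0 p %/ b ^ (\sum_i l i) < A) &&
    [forall i, G (lift ord0 i) p %/ b ^ (n - l i) == a i])%N s in
  (c <= A * b ^ t)%N /\ ((A <= b ^ (n - \sum_i l i))%N -> c = (A * b ^ t)%N).
Proof.
move=> ln al; elim: A => [|A [IHle IHeq]].
  by rewrite /= (eq_count (a2 := pred0)) ?count_pred0.
set c := count _ _ in IHle IHeq.
set z := count (fun p => (G ord0 p %/ b ^ (\sum_i l i) == A) &&
    [forall i, G (lift ord0 i) p %/ b ^ (n - l i) == a i])%N s.
have -> /= : count (fun p => (G ord0 p %/ b ^ (\sum_i l i) < A.+1) &&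
    [forall i, G (lift ord0 i) p %/ b ^ (n - l i) == a i])%N s = (c + z)%N.
  rewrite /c /z !count_sum -big_split; apply: eq_bigr => p _ /=.
  by case: [forall i, _]; rewrite ?andbF ?andbT// ltnS leq_eqVlt;
    case: eqP => [->|]; rewrite ?ltnn ?addn0//.
have [Al|lA] := ltnP A (b ^ (n - \sum_i l i)).
  have -> : z = (b ^ t)%N by apply: net_slice.
  by split=> [|_]; rewrite mulSn addnC ?leq_add2l// IHeq// ltnW.
suff -> : z = 0%N by rewrite addn0; split=> [|]; [lia|lia].
rewrite /z (eq_count (a2 := pred0)) ?count_pred0// => p /=.
apply/negP => /andP[/eqP GA _]; move: lA; apply/negP; rewrite -ltnNge -GA.
by rewrite expnB// ltn_divLR ?expn_gt0 ?b_gt0// divnK ?G_lt// dvdn_exp2l.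
Qed.

(** If S = \sum l_i <= n, put y = floor(Y / b^S): count and expectation both lie between y b^t and
    (y + 1) b^t. If S > n, both lie between 0 and b^t. *)
Lemma net_elementary_box (l a : 'I_e -> nat) (Y : nat) :
  (forall i, l i <= n)%N -> (forall i, a i < b ^ l i)%N -> (Y <= b ^ n)%N ->
  `| (count (fun p => (G ord0 p < Y) &&
       [forall i, G (lift ord0 i) p %/ b ^ (n - l i) == a i])%N s)%:R
     - b%:R ^+ (t + n) * (Y%:R / b%:R ^+ n) / b%:R ^+ (\sum_i l i)%N |
  <= b%:R ^+ t :> R.
Proof.
move=> l_n al Yn; set c := count _ _; set S := (\sum_i l i)%N.
have b0 : 0 < b%:R :> R by rewrite ltr0n.
have bX0 k : b%:R ^+ k != 0 :> R by rewrite expf_neq0// gt_eqF.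
have [Sn|nS] := leqP S n.
  have -> : b%:R ^+ (t + n) * (Y%:R / b%:R ^+ n) / b%:R ^+ S =
      b%:R ^+ t * (Y%:R / b%:R ^+ S) :> R.
    by rewrite exprD; field; rewrite !bX0.
  pose y := (Y %/ b ^ S)%N.
  have yn : (y <= b ^ (n - S))%N.
    by rewrite expnB// leq_div2r.
  have [_ /(_ yn) cy] := net_slab y Sn al.
  have [cy1 _] := net_slab y.+1 Sn al.
  have c_ge : (y * b ^ t <= c)%N.
    rewrite -cy; apply: sub_count => p /andP[Gy ->]; rewrite andbT.
    by move: Gy; apply: contraTT; rewrite -!leqNgt; apply: leq_div2r.
  have c_le : (c <= y.+1 * b ^ t)%N.
    apply: leq_trans cy1; apply: sub_count => p /andP[Gy ->]; rewrite andbT.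
    by rewrite ltnS leq_div2r// ltnW.
  have V_ge : y%:R <= Y%:R / b%:R ^+ S :> R.
    by rewrite ler_pdivlMr ?exprn_gt0// -natrX -natrM ler_nat leq_divM.
  have V_le : Y%:R / b%:R ^+ S <= y.+1%:R :> R.
    rewrite ler_pdivrMr ?exprn_gt0// -natrX -natrM ler_nat ltnW// ltn_ceil//.
    by rewrite expn_gt0 b_gt0.
  have bt0 : 0 < b%:R ^+ t :> R by rewrite exprn_gt0.
  move: c_ge c_le; rewrite -!(ler_nat R) !natrM !natrX => c_ge c_le.
  rewrite ler_norml; move: V_ge V_le.
  rewrite -(ler_pM2l bt0) -[_ <= y.+1%:R](ler_pM2l bt0).
  rewrite -natr1 in c_le *.
  lra.
(* Shortening l to total n encloses the box in a single elementary interval, unrestricted in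
   coordinate 0. *)
have [l' l'l l'n] := sum_truncate (ltnW nS).
have c_le : (c <= b ^ t)%N.
  rewrite -(@net_slice l' (fun i => a i %/ b ^ (l i - l' i))%N 0%N).
  - apply: sub_count => p /andP[_ /forallP Ga]; apply/andP; split.
      by rewrite l'n divn_small// G_lt.
    apply/forallP => i; rewrite -(eqP (Ga i)) -divnMA -expnD.
    have -> // : (n - l i + (l i - l' i) = n - l' i)%N.
    by have := l'l i; have := l_n i; lia.
  - by rewrite l'n.
  - move=> i; rewrite ltn_divLR ?expn_gt0 ?b_gt0// -expnD subnKC//; exact: al.
  - by rewrite l'n subnn.
have VE : b%:R ^+ (t + n) * (Y%:R / b%:R ^+ n) / b%:R ^+ S =
    b%:R ^+ t * ((Y%:R / b%:R ^+ n) / b%:R ^+ (S - n)) :> R.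
  by rewrite -[in LHS](subnK (ltnW nS)) !exprD; field; rewrite !bX0.
have V_ge : 0 <= b%:R ^+ (t + n) * (Y%:R / b%:R ^+ n) / b%:R ^+ S :> R.
  by rewrite !mulr_ge0// ?invr_ge0 ?exprn_ge0// ltW.
have V_le : b%:R ^+ (t + n) * (Y%:R / b%:R ^+ n) / b%:R ^+ S <= b%:R ^+ t :> R.
  rewrite VE ler_piMr ?exprn_ge0 ?(ltW b0)// mulr_ile1//.
  - by rewrite ler_pdivrMr ?exprn_gt0// mul1r -natrX ler_nat.
  - by rewrite invf_le1 ?exprn_gt0// exprn_ege1// ler1n.
move: c_le; rewrite -(ler_nat R) natrX => c_le.
have c_ge : 0 <= c%:R :> R by [].
rewrite ler_norml; lra.
Qed.

Lemma forall_prod (Q : pred 'I_e) :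
  [forall i, Q i]%:R = \prod_i (Q i)%:R :> R.
Proof.
have [/forallP Qi|] := boolP [forall i, Q i].
  by rewrite big1// => i _; rewrite Qi.
by case/forallPn => i /negPf Qi; rewrite (bigD1 i)//= Qi mul0r.
Qed.

(** Distributing the product over the last e coordinates gives one term for each of the (b (n +
    1))^e choices f of pieces, and each term costs at most b^t. *)
Lemma net_box (Y : 'I_e.+1 -> nat) : (forall j, Y j <= b ^ n)%N ->
  `| (count (fun p => [forall j, G j p < Y j]%N) s)%:R
     - b%:R ^+ (t + n) * \prod_j ((Y j)%:R / b%:R ^+ n) |
  <= b%:R ^+ t * (b%:R * n.+1%:R) ^+ e :> R.
Proof.
move=> Yn; pose X := ('I_n.+1 * 'I_b)%type.
pose Y' i := Y (lift ord0 i); pose G' i p := G (lift ord0 i) p.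
pose vol i (x : X) : R := (piece_proper (n := n) (Y' i) x * b ^ x.1)%:R / b%:R ^+ n.
pose c (f : {ffun 'I_e -> X}) := \sum_(p <- s) (G ord0 p < Y ord0)%:R *
  \prod_i (in_piece (Y' i) (f i) (G' i p))%:R : R.
pose v (f : {ffun 'I_e -> X}) := b%:R ^+ (t + n) * ((Y ord0)%:R / b%:R ^+ n) *
  \prod_i vol i (f i) : R.
have cE : (count (fun p => [forall j, G j p < Y j]%N) s)%:R = \sum_f c f.
  rewrite exchange_big count_sum natr_sum; apply: eq_bigr => p _ /=.
  rewrite -mulr_sumr forall_ord_recl -mulnb natrM; congr (_ * _).
  rewrite -(bigA_distr_bigA (fun i x => (in_piece (Y' i) x (G' i p))%:R : R)).
  rewrite forall_prod.
  apply: eq_bigr => i _; rewrite -natr_sum sum_in_piece//; exact: Yn.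
have vE : b%:R ^+ (t + n) * \prod_j ((Y j)%:R / b%:R ^+ n) = \sum_f v f.
  rewrite -mulr_sumr -(bigA_distr_bigA vol) big_ord_recl mulrA; congr (_ * _).
  apply: eq_bigr => i _; rewrite -mulr_suml -natr_sum sum_piece_volume//.
  exact: Yn.
rewrite cE vE -sumrB; apply: le_trans (ler_norm_sum _ _ _) _.
have -> : b%:R ^+ t * (b%:R * n.+1%:R) ^+ e =
    \sum_(f : {ffun 'I_e -> X}) b%:R ^+ t :> R.
  rewrite sumr_const card_ffun card_prod !card_ord -[RHS]mulr_natr; congr (_ * _).
  by rewrite natrX natrM mulrC.
apply: ler_sum => f _.
(* A choice with an improper piece contributes 0 to both count and volume. *)
have [/forallP fP|/forallPn[i /negPf fi]] :=
    boolP [forall i, piece_proper (Y' i) (f i)]; last first.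
  rewrite /c /v big1 => [|p _]; last first.
    by rewrite (bigD1 i)//= /in_piece fi mul0r mulr0.
  by rewrite (bigD1 i)//= /vol fi mul0n mul0r mul0r mulr0 subrr normr0 exprn_ge0.
pose l i := (n - (f i).1)%N; pose a i := piece_index (Y' i) (f i).
have fn i : ((f i).1 <= n)%N by rewrite -ltnS ltn_ord.
have al i : (a i < b ^ l i)%N by apply: piece_index_lt => //; apply: Yn.
have := net_elementary_box (fun i => leq_subr _ _) al (Yn ord0).
congr (`| _ - _ | <= _).
  rewrite count_sum natr_sum; apply: eq_bigr => p _.
  rewrite -mulnb natrM; congr (_ * _); rewrite forall_prod.
  by apply: eq_bigr => i _; rewrite /in_piece fP subKn.
congr (_ * _); rewrite -prodrXr -prodfV; apply: eq_bigr => i _.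
have nE : b%:R ^+ n = b%:R ^+ (f i).1 * b%:R ^+ l i :> R.
  by rewrite -exprD subnKC.
rewrite /vol fP mul1n natrX nE invfM mulrA.
by rewrite mulfV ?mul1r// expf_neq0// pnatr_eq0 gtn_eqF.
Qed.

End NetBoxes.

(** * Integers and real numbers read from digits *)

Section DigitValue.
Variable b : nat.
Hypothesis b_gt1 : (1 < b)%N.
Implicit Types D : nat -> nat.

Fixpoint digit_value D n : nat :=
  if n is n'.+1 then (digit_value D n' * b + D n')%N else 0%N.

Lemma digit_value_div D n l : (forall i, D i < b)%N -> (l <= n)%N ->
  (digit_value D n %/ b ^ (n - l) = digit_value D l)%N.
Proof.
move=> Db ln; rewrite -{1}(subnK ln); elim: (n - l)%N => [|k IH].
  by rewrite expn0 divn1.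
by rewrite expnS divnMA addSn /= divnMDl ?(ltnW b_gt1)// (divn_small (Db _)) addn0.
Qed.

Lemma digit_value_lt D n : (forall i, D i < b)%N -> (digit_value D n < b ^ n)%N.
Proof.
move=> Db; elim: n => //= n IH.
have := Db n; have : (digit_value D n * b + b <= b ^ n * b)%N.
  by rewrite -mulSnr leq_mul2r IH orbT.
by rewrite expnSr; lia.
Qed.

Lemma digit_value_inj D D' n : (forall i, D i < b)%N -> (forall i, D' i < b)%N ->
  digit_value D n = digit_value D' n <-> (forall i, (i < n)%N -> D i = D' i).
Proof.
move=> Db D'b; elim: n => [|n IH]; first by split.
split=> [/= e|DD'] => [i|].
  have eD : D n = D' n.
    have := congr1 (modn^~ b) e; rewrite !modnMDl !modn_small//.
  rewrite ltnS leq_eqVlt => /predU1P[->//|]; apply/(proj1 IH).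
  have /eqP := e; rewrite eD eqn_add2r eqn_pmul2r ?(ltnW b_gt1)//.
  by move/eqP.
by rewrite /= DD'// (proj2 IH)// => i il; apply: DD'; apply: ltnW.
Qed.

Lemma digit_value_onto a n : (a < b ^ n)%N ->
  exists2 D, (forall i, D i < b)%N & digit_value D n = a.
Proof.
have b_gt0 : (0 < b)%N by apply: ltnW.
elim: n a => [|n IH] a an.
  by exists (fun=> 0%N) => //; move: an; rewrite expn0; case: a.
have [|D Db Da] := IH (a %/ b)%N; first by rewrite ltn_divLR// -expnSr.
exists (fun i => if i == n then a %% b else D i)%N.
  by move=> i; case: eqP => // _; rewrite ltn_mod.
rewrite /= eqxx [RHS](divn_eq a b); congr (_ * _ + _)%N.
have D'b i : ((if i == n then a %% b else D i) < b)%N.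
  by case: eqP => // _; rewrite ltn_mod.
rewrite -Da; apply/digit_value_inj => // i il.
by case: eqP il => // ->; rewrite ltnn.
Qed.

End DigitValue.

Section DigitExpansion.
Variables (R : realType) (b : nat).
Hypothesis b_prime : prime b.
Implicit Types f : laurent 'F_b.

Definition ldigit f (i : nat) : nat := lcoef f (i.+1)%:Z.

Lemma ltn_Fp (c : 'F_b) : (c < b)%N.
Proof. by have := ltn_ord c; rewrite [X in (_ < X)%N]Fp_cast. Qed.

Lemma ldigit_lt f i : (ldigit f i < b)%N. Proof. exact: ltn_Fp. Qed.

Lemma lphi_bounds f n : lord_ge 1 f ->
  (digit_value b (ldigit f) n)%:R / b%:R ^+ n <= lphi R f
    <= (digit_value b (ldigit f) n).+1%:R / b%:R ^+ n.
Proof.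
move=> f1; have b_gt1 := prime_gt1 b_prime.
have b0 : 0 < b%:R :> R by rewrite ltr0n (ltnW b_gt1).
have bX0 k : 0 < b%:R ^+ k :> R by rewrite exprn_gt0.
pose V N := digit_value b (ldigit f) N.
have [W WE] : exists W : nat, lord f = W%:Z.
  have [->|f0] := eqVneq f 0.
    by exists 0%N; rewrite /lord; case: xgetP => // x _ []; rewrite lcoef0 eqxx.
  by move/(lord_ge_lord _ f0): f1 => f1; exists `|lord f|%N; lia.
set u := fun k : nat => (lcoef f (lord f + k%:Z) : nat)%:R *
  b%:R ^ (- (lord f + k%:Z)) : R^o.
(* The series starts at position W, so K + 1 terms reach position W + K; the digits before W are
   0. *)
have sE K : series u K.+1 = (V (W + K)%N)%:R / b%:R ^+ (W + K).
  pose T (i : nat) : R := (lcoef f i%:Z : nat)%:R / b%:R ^+ i.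
  have TE N : \sum_(0 <= i < N.+1) T i = (V N)%:R / b%:R ^+ N.
    elim: N => [|N IH].
      by rewrite big_nat1 /T f1// expr0 divr1.
    rewrite big_nat_recr// IH /T /V /= natrD natrM exprS -/(ldigit f N).
    by field; rewrite !gt_eqF.
  rewrite -TE -addnS (big_cat_nat (n := W)) ?leq_addr//=.
  rewrite big_nat_cond big1 ?add0r => [|i /andP[/andP[_ iW] _]]; last first.
    by rewrite /T (@lord_geP _ f) ?WE ?mul0r.
  rewrite -{1}[W]add0n big_addn addKn; apply: eq_bigr => k _.
  by rewrite /u WE -PoszD addnC -invr_expz.
have sV N : (n <= N)%N -> (V n)%:R / b%:R ^+ n <= ((V N)%:R / b%:R ^+ N : R) <=
   (V n).+1%:R / b%:R ^+ n.
  move=> nN; have := digit_value_div b_gt1 (ldigit_lt f) nN.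
  rewrite -/(V N) -/(V n) => <-.
  have -> : b%:R ^+ N = b%:R ^+ (N - n) * b%:R ^+ n :> R by rewrite -exprD subnK.
  rewrite invfM mulrA !ler_pM2r ?invr_gt0//.
  rewrite ler_pdivlMr// ler_pdivrMr// -natrX -!natrM !ler_nat leq_divM/=.
  by rewrite ltnW// ltn_ceil// expn_gt0 (ltnW b_gt1).
have u_ge0 k : 0 <= u k by rewrite mulr_ge0// exprz_ge0// ltW.
have u_nd : nondecreasing_seq (series u) by apply: nondecreasing_series.
have u_cv : cvgn (series u).
  apply: nondecreasing_is_cvgn => //; exists 1 => _ [K _ <-].
  apply: le_trans (u_nd _ _ (leqnSn K)) _; rewrite sE.
  rewrite ler_pdivrMr// mul1r -natrX ler_nat ltnW//.
  by apply: digit_value_lt => //; apply: ldigit_lt.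
have large K : (n < K)%N -> (V n)%:R / b%:R ^+ n <= series u K <=
   (V n).+1%:R / b%:R ^+ n.
  by case: K => // K nK; rewrite sE; apply: sV; lia.
rewrite /lphi -/u; apply/andP; split.
  by apply: limr_ge => //; exists n.+1 => // K /= /large/andP[].
by apply: limr_le => //; exists n.+1 => // K /= /large/andP[].
Qed.

End DigitExpansion.

(** Factors are replaced one at a time; the others lie in [0, 1], so each replacement costs at most
    eps. *)
Lemma prod_le_diff (R : realFieldType) (I : Type) (r : seq I) (u v : I -> R) eps :
  (forall i, 0 <= u i) -> (forall i, u i <= v i) -> (forall i, v i <= 1) ->
  (forall i, v i - u i <= eps) ->
  \prod_(i <- r) v i - \prod_(i <- r) u i <= (size r)%:R * eps.
Proof.
move=> u0 uv v1 uveps.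
elim: r => [|i r IH]; first by rewrite !big_nil subrr mul0r.
rewrite !big_cons /= -natr1 mulrDl mul1r.
have v0 j : 0 <= v j by apply: le_trans (uv j).
set V := \prod_(j <- r) v j in IH *; set U := \prod_(j <- r) u j in IH *.
have U0 : 0 <= U by apply: prodr_ge0.
have UV : U <= V by apply: ler_prod => j _; rewrite u0 uv.
have V1 : V <= \prod_(j <- r) 1 by apply: ler_prod => j _; rewrite v0 v1.
rewrite big1_eq in V1.
have -> : v i * V - u i * U = v i * (V - U) + (v i - u i) * U by ring.
apply: lerD.
  by apply: le_trans IH; rewrite ler_piMl ?subr_ge0.
apply: le_trans (uveps i); rewrite ler_piMr ?subr_ge0//; lra.
Qed.

Lemma nat_ceil (R : realFieldType) (z : R) (B : nat) : z <= B%:R ->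
  exists Y : nat, [/\ (Y <= B)%N, z <= Y%:R & forall k : nat, (k < Y)%N -> k%:R < z].
Proof.
move=> zB; have ex : exists k : nat, z <= k%:R by exists B.
case: (ex_minnP ex) => Y zY Ymin; exists Y; split => //; first exact: Ymin.
by move=> k kY; rewrite ltNge; apply/negP => /Ymin; lia.
Qed.

Lemma card_fset_set_count (T : choiceType) (P : set T) (Q : pred T) :
  finite_set P ->
  #|` fset_set (P `&` [set p | Q p])| = count Q (enum_fset (fset_set P)).
Proof.
move=> Pfin; rewrite -size_filter; apply/eqP.
rewrite -uniq_size_uniq ?filter_uniq ?fset_uniq// => p.
have PQfin : finite_set (P `&` [set p | Q p]) by apply: finite_setIl.
rewrite mem_filter !in_fset_set//; apply/andP/idP => [[Qp]|].
  by rewrite !in_setE.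
by rewrite !in_setE => -[].
Qed.

Lemma sub_in_count (T : eqType) (a1 a2 : pred T) (r : seq T) :
  {in r, subpred a1 a2} -> (count a1 r <= count a2 r)%N.
Proof.
elim: r => //= x r IH a12; apply: leq_add.
  by have := a12 x (mem_head _ _); case: (a1 x) => // ->.
by apply: IH => z zr; apply: a12; rewrite inE zr orbT.
Qed.

(** * Star-discrepancy of a net *)

Section NetDiscrepancy.
Variables (R : realType) (b e t n : nat) (P : set 'cV[laurent 'F_b]_e.+1).
Hypothesis b_prime : prime b.
Hypothesis P_cube : P `<=` @unit_cube _ _.
Hypothesis P_card : (P #= `I_(b ^ (t + n)))%card.
Hypothesis P_net : forall (l : 'I_e.+1 -> nat) v, (\sum_j l j)%N = n ->
  (P `&` [set g | digits l g = v] #= `I_(b ^ t))%card.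

Let P_fin : finite_set P. Proof. by apply/finite_setP; eexists; exact: P_card. Qed.
Let s := enum_fset (fset_set P).
Let G (j : 'I_e.+1) (p : 'cV[laurent 'F_b]_e.+1) :=
  digit_value b (ldigit (p j 0)) n.
Let b_gt1 : (1 < b)%N. Proof. exact: prime_gt1. Qed.

(** Dividing by b^(n - l j) keeps the first l j digits, and a j is the value of a unique string of l
    j digits; the interval is the fibre of [digits] over these strings. *)
Lemma count_elementary_interval (l a : 'I_e.+1 -> nat) : (\sum_j l j)%N = n ->
  (forall j, (a j < b ^ l j)%N) ->
  count (fun p => [forall j, G j p %/ b ^ (n - l j) == a j]%N) s = (b ^ t)%N.
Proof.
move=> ln al.
have /choice[D DP] j : exists D,
    (forall i, D i < b)%N /\ digit_value b D (l j) = a j.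
  by have [D Db Da] := digit_value_onto b_gt1 (al j); exists D.
pose v : 'rV['F_b]_#|{: {j : 'I_e.+1 & 'I_(l j)}}| :=
  \row_k (D (tag (digit_pos k)) (tagged (digit_pos k)))%:R.
have l_le j : (l j <= n)%N by rewrite -ln (bigD1 j)//= leq_addr.
rewrite -(card_fset_set (P_net v ln)) -card_fset_set_count//.
congr #|` fset_set (_ `&` _)|.
apply/seteqP; split=> [p /forallP pa|p /= /rowP pv] /=.
  apply/rowP => k; rewrite !mxE; case: (digit_pos k) => j i /=.
  have [Db Da] := DP j; have := eqP (pa j).
  rewrite /G digit_value_div//; last by move=> ?; apply: ldigit_lt.
  rewrite -Da => /(digit_value_inj b_gt1); move=> /(_ (ldigit_lt b_prime _) Db).
  move=> /(_ i (ltn_ord i)) <-; by rewrite natr_Zp.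
apply/forallP => j; have [Db Da] := DP j.
rewrite /G digit_value_div//; last by move=> ?; apply: ldigit_lt.
rewrite -Da; apply/eqP/(digit_value_inj b_gt1) => // [|i il].
  exact: ldigit_lt.
have := pv (enum_rank (Tagged (fun j => 'I_(l j)) (Ordinal il))).
rewrite !mxE /digit_pos enum_rankK /= /ldigit => ->.
by rewrite val_Fp_nat// modn_small.
Qed.

(** With Y the rounding up of b^n y, the count for [0, y) lies between those for the corners Y - 1
    and Y. Each rounding changes the volume by at most (e + 1) / b^n, and [net_box] handles the
    counts. *)
Lemma net_star_discrepancy :
  (star_discrepancy P (map_mx (@lphi b R)) <=
   (((b%:R * n.+1%:R) ^+ e + e.+1%:R) / b%:R ^+ n)%:E)%E.
Proof.
apply: ge_ereal_sup => _ [y y01 <-]; rewrite lee_fin.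
have b0 : 0 < b%:R :> R by rewrite ltr0n (ltnW b_gt1).
have bX0 k : 0 < b%:R ^+ k :> R by rewrite exprn_gt0.
have /choice[Y YP] j : exists Y : nat, [/\ (Y <= b ^ n)%N,
    y j 0 * b%:R ^+ n <= Y%:R &
    forall k : nat, (k < Y)%N -> k%:R < y j 0 * b%:R ^+ n].
  apply: nat_ceil; rewrite natrX ler_piMl ?exprn_ge0 ?(ltW b0)//.
  by case/andP: (y01 j).
pose Q (p : 'cV[laurent 'F_b]_e.+1) :=
  `[< forall j, 0 <= map_mx (@lphi b R) p j 0 < y j 0 >].
have -> : [set p | forall j, 0 <= map_mx (@lphi b R) p j 0 < y j 0] = [set p | Q p].
  by apply/seteqP; split=> p /asboolP.
rewrite card_fset_set_count// (card_fset_set P_card) -/s natrX.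
set c := count Q s.
have G_lt j p : (G j p < b ^ n)%N.
  by apply: digit_value_lt => // i; apply: ldigit_lt.
have box Z (Zn : forall j, (Z j <= b ^ n)%N) :=
  @net_box R _ _ _ _ _ _ _ b_gt1 G_lt count_elementary_interval Z Zn.
have phiP p j : p \in s -> (G j p)%:R / b%:R ^+ n <= lphi R (p j 0)
    <= (G j p).+1%:R / b%:R ^+ n.
  rewrite /s in_fset_set// in_setE => /P_cube/unit_cubeP pU.
  exact: lphi_bounds.
have c_le : (c <= count (fun p => [forall j, G j p < Y j]%N) s)%N.
  apply: sub_in_count => p ps /asboolP pQ; apply/forallP => j.
  have [_ yY _] := YP j; have /andP[_] := pQ j; rewrite mxE => phi_lt.
  have /andP[G_le _] := phiP _ j ps.
  rewrite -(ltr_nat R); apply: lt_le_trans yY.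
  by rewrite -ltr_pdivrMr//; apply: le_lt_trans phi_lt.
(* From G < Y - 1 follows G + 1 < Y, hence (G + 1) / b^n < y; this gives the strict bound on [lphi].
   For Y = 0 the predecessor is 0 and the inner box is empty. *)
have c_ge : (count (fun p => [forall j, G j p < (Y j).-1]%N) s <= c)%N.
  apply: sub_in_count => p ps /forallP pG; apply/asboolP => j; rewrite mxE.
  have [_ _ Yy] := YP j; have /andP[le_phi phi_le] := phiP _ j ps.
  apply/andP; split.
    by apply: le_trans le_phi; rewrite divr_ge0// ltW.
  apply: le_lt_trans phi_le _; rewrite ltr_pdivrMr//; apply: Yy.
  by have := pG j; lia.
have YB j : (Y j <= b ^ n)%N by case: (YP j).
have YB1 j : ((Y j).-1 <= b ^ n)%N by apply: leq_trans (leq_pred _) (YB j).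
have y0 j : 0 <= y j 0 by case/andP: (y01 j).
have y1 j : y j 0 <= 1 by case/andP: (y01 j).
have outer : \prod_j ((Y j)%:R / b%:R ^+ n) - \prod_j y j 0 <=
    e.+1%:R * (b%:R ^+ n)^-1.
  rewrite -[e.+1 in leRHS]size_enum_ord -!big_enum.
  apply: prod_le_diff => // j; have [_ yY Yy] := YP j.
  - by rewrite ler_pdivlMr.
  - by rewrite ler_pdivrMr// mul1r -natrX ler_nat.
  - rewrite -[y j 0 in leLHS](mulfK (lt0r_neq0 (bX0 n))) -mulrBl -[leRHS]mul1r.
    rewrite ler_pM2r ?invr_gt0//; have := mulr_ge0 (y0 j) (ltW (bX0 n)).
    case: (Y j) Yy => [_|k /(_ k (ltnSn k))]; rewrite -?natr1; lra.
have inner : \prod_j y j 0 - \prod_j ((Y j).-1%:R / b%:R ^+ n) <=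
    e.+1%:R * (b%:R ^+ n)^-1.
  rewrite -[e.+1 in leRHS]size_enum_ord -!big_enum.
  apply: prod_le_diff => // j; have [_ yY Yy] := YP j.
  - rewrite ler_pdivrMr//; case: (Y j) Yy => [_|k /(_ k (ltnSn k))/ltW]//.
    by rewrite mulr_ge0// ltW.
  - rewrite -[y j 0 in leLHS](mulfK (lt0r_neq0 (bX0 n))) -mulrBl -[leRHS]mul1r.
    rewrite ler_pM2r ?invr_gt0//; case: (Y j) yY => [|k]; rewrite -?natr1 /=; lra.
set E := b%:R ^+ t * (b%:R * n.+1%:R) ^+ e : R.
have := box _ YB; have := box _ YB1; rewrite !ler_norml -/E.
move=> /andP[lo _] /andP[_ hi].
move: c_le c_ge; rewrite -!(ler_nat R) => c_le c_ge.
set N : R := b%:R ^+ (t + n); have N0 : 0 < N by apply: bX0.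
rewrite mulrDl.
have -> : (b%:R * n.+1%:R) ^+ e / b%:R ^+ n = E / N.
  by rewrite /E /N exprD; field; rewrite !gt_eqF.
have up : c%:R / N <= \prod_j ((Y j)%:R / b%:R ^+ n) + E / N.
  rewrite ler_pdivrMr// mulrDl divfK ?gt_eqF//; rewrite -/N in hi; lra.
have down : \prod_j ((Y j).-1%:R / b%:R ^+ n) - E / N <= c%:R / N.
  rewrite ler_pdivlMr// mulrBl divfK ?gt_eqF//; rewrite -/N in lo; lra.
lra.
Qed.

End NetDiscrepancy.

(** * The dual minimum *)

(** [infimum] only selects an existing greatest lower bound. It is -oo without a finite lower bound,
    +oo if there is one but no finite element, and otherwise a least element found by
    well-ordering. *)
Lemma infimum_int_lbound (S : set (\bar int)) : lbound S (infimum +oo%E S).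
Proof.
suff [x Sx] : infimums S !=set0.
  rewrite /infimum; case: eqP => [-> //|_].
  by case: xgetP => [y _ []//|/(_ x)].
have [[z Sz]|noz] := pselect (exists z : int, lbound S z%:E); last first.
  exists -oo%E; split=> [x _|[r| |] Sr]; rewrite ?leNye//; exfalso; apply: noz.
    by exists r.
  by exists 0; move=> x /Sr; apply: le_trans; rewrite leey.
have SNy : ~ S -oo%E by move=> /Sz; rewrite leeNy_eq.
have [[w Sw]|now] := pselect (exists w : int, S w%:E); last first.
  exists +oo%E; split=> [[r| |] Sr|x _]; rewrite ?leey//; exfalso => //.
  by apply: now; exists r.
have ex : exists k : nat, `[< S (z + k%:Z)%:E >].
  exists `|w - z|%N; apply/asboolP; have := Sz _ Sw; rewrite lee_fin => zw.
  by rewrite (_ : z + _ = w)//; lia.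
case: (ex_minnP ex) => k /asboolP Sk kmin.
exists (z + k%:Z)%:E; split=> [[r| |] Sr|x]; rewrite ?leey//; last by apply.
have := Sz _ Sr; rewrite !lee_fin => zr.
suff : (k <= `|r - z|)%N by lia.
by apply: kmin; apply/asboolP; rewrite (_ : z + _ = r)//; lia.
Qed.

Lemma cdivide_lattice (F : fieldType) d (f : 'cV[laurent F]_d)
    (T : 'M[laurent F]_d) :
  cdivide f (lattice T) = lattice (diag_mx (\row_j ((f j 0)^-1)) *m T).
Proof.
have fE (g : 'cV[laurent F]_d) :
    \col_j ((f j 0)^-1 * g j 0) = diag_mx (\row_j ((f j 0)^-1)) *m g.
  by apply/matrixP => j k; rewrite mul_diag_mx !mxE ord1.
apply/seteqP; split=> [_ [_ [a _ <-] <-]|_ [a _ <-]].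
  by rewrite fE mulmxA; exists a.
by exists (T *m map_mx (@lpoly F) a); [exists a|rewrite fE mulmxA].
Qed.

(* Multiplying a dual vector of f^-1 X by f^-1 gives a dual vector of X, so
   short dual vectors of f^-1 X are ruled out by M(X). *)
Lemma dual_cdivide_min (F : fieldType) d (f : 'cV[laurent F]_d)
    (X : set 'cV[laurent F]_d) (l : 'I_d -> nat) (y : 'cV[laurent F]_d) :
  (forall j, f j 0 != 0) ->
  ((\sum_j ((l j)%:Z - 1 + lord (f j 0)))%:E < lattice_min X)%E ->
  dual_lattice (cdivide f X) y ->
  (forall j, lord_ge (1 - (l j)%:Z) (y j 0)) -> y = 0.
Proof.
move=> f0 lM yX yl; apply/eqP/negPn/negP => y0.
pose g := \col_j ((f j 0)^-1 * y j 0).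
have gX : dual_lattice X g.
  move=> h Xh.
  have [p _ pE] := yX (\col_j ((f j 0)^-1 * h j 0)) (ex_intro2 _ _ h Xh erefl).
  exists p => //; rewrite pE; apply: eq_bigr => j _; rewrite !mxE.
  by rewrite mulrCA mulrA.
have g0 : g <> 0.
  move=> /matrixP g0; case/eqP: y0; apply/matrixP => j k; rewrite ord1 mxE.
  apply/eqP; have /eqP := g0 j 0; rewrite !mxE mulf_eq0 invr_eq0.
  by rewrite (negPf (f0 j)).
have : (lattice_min X <= \sum_j ldeg (g j 0%R))%E.
  by apply: infimum_int_lbound; exists g.
rewrite leNgt => /negP; apply; apply: le_lt_trans lM.
rewrite -sumEFin; apply: lee_sum => j _.
rewrite -[X in X%:E]opprK; apply/ldeg_le.
rewrite mxE (_ : - _ = - lord (f j 0) + (1 - (l j)%:Z)); last by lia.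
by apply: lord_geM => //; rewrite -lordV//; apply: lord_geP.
Qed.

(** * The lattice divided by f *)

Section Assembly.
Variables (b e : nat) (T L Q : 'M[laurent 'F_b]_e.+1).
Variable f : 'cV[laurent 'F_b]_e.+1.
Hypothesis b_prime : prime b.
Hypothesis T_unit : T \in unitmx.
Hypothesis TE : T = L *m Q.
Hypothesis L_trig : is_trig_mx L.
Hypothesis Q_deg : forall i j, (ldeg (Q i j) <= 0)%E.
Hypothesis Q_det : \det Q = 1.
Hypothesis f_deg : forall j, (0 <= ldeg (f j 0%R))%E.
Hypothesis fL_deg :
  forall j i : 'I_e.+1, (i <= j)%N -> (ldeg (L j i) <= ldeg (f j 0%R))%E.

Let X := lattice T.
Let P := cdivide f X `&` @unit_cube 'F_b _.
Let L' := diag_mx (\row_j ((f j 0)^-1)) *m L.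
Let n j := `|lord (L' j j)|%N.

Lemma ldeg_ge0_neq0 j : f j 0 != 0.
Proof. by have := f_deg j; rewrite /ldeg; case: eqP. Qed.

Lemma scaledE i j : L' i j = (f i 0)^-1 * L i j.
Proof. by rewrite /L' mul_diag_mx !mxE. Qed.

Lemma scaled_trig : is_trig_mx L'.
Proof.
apply/is_trig_mxP => i j ij; rewrite scaledE.
by move/is_trig_mxP: L_trig => ->//; rewrite mulr0.
Qed.

(** The bounds on deg f_j make diag(f^-1) L integral on and below the diagonal; above it the entries
    are 0. *)
Lemma scaled_int i j : lord_ge 0 (L' i j).
Proof.
have [ij|ji] := ltnP i j.
  by move/is_trig_mxP: scaled_trig => ->.
rewrite scaledE (_ : 0 = - lord (f i 0) + lord (f i 0)); last by lia.
apply: lord_geM; first by rewrite -lordV ?ldeg_ge0_neq0//; apply: lord_geP.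
by apply/ldeg_le; rewrite -ldegE ?ldeg_ge0_neq0// fL_deg.
Qed.

Lemma det_trig_mul : \det T = \prod_j L j j.
Proof. by rewrite TE det_mulmx Q_det mulr1 det_trig. Qed.

Lemma L_diag j : L j j != 0.
Proof.
move: T_unit; rewrite unitmxE unitfE det_trig_mul; apply: contraNneq => Lj.
by rewrite (bigD1 j)//= Lj mul0r.
Qed.

Lemma scaled_diag j : L' j j != 0.
Proof. by rewrite scaledE mulf_neq0 ?invr_eq0 ?ldeg_ge0_neq0 ?L_diag. Qed.

Lemma scaled_lord j : lord (L' j j) = n j.
Proof.
have /(lord_ge_lord _ (scaled_diag j)) := @scaled_int j j.
by rewrite /n; lia.
Qed.

Lemma Q_int i j : lord_ge 0 (Q i j).
Proof. by apply/ldeg_le; rewrite oppr0. Qed.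

Lemma points_lattice : P = lattice (L' *m Q) `&` @unit_cube 'F_b _.
Proof. by rewrite /P /X cdivide_lattice TE /L' mulmxA. Qed.

Lemma card_points : (P #= `I_(b ^ \sum_j n j))%card.
Proof.
rewrite points_lattice; apply: card_lattice_points => //.
- exact: scaled_trig.
- exact: scaled_int.
- exact: scaled_diag.
- exact: scaled_lord.
- exact: Q_int.
Qed.

(** Since det Q = 1, only the diagonal of L enters det T. In degrees, \sum n_j is the exponent m. *)
Lemma sum_lord_scaled : (\sum_j n j)%:Z = lord (\det T) - \sum_j lord (f j 0).
Proof.
rewrite det_trig_mul lord_prod; last exact: L_diag.
rewrite -sumrB -[LHS]natz natr_sum; apply: eq_bigr => j _.
rewrite natz -scaled_lord scaledE lordM ?invr_eq0 ?ldeg_ge0_neq0 ?L_diag//.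
by rewrite lordV ?ldeg_ge0_neq0// addrC.
Qed.

(** In terms of the integers t and m the condition reads \sum l_j <= m - t. *)
Lemma card_points_cylinder (l : 'I_e.+1 -> nat) v :
  (((\sum_j l j)%:Z - e.+1%:Z + \sum_j lord (f j 0))%:E < lattice_min X)%E ->
  exists2 k, (\sum_j n j = k + \sum_j l j)%N &
  (P `&` [set g | digits l g = v] #= `I_(b ^ k))%card.
Proof.
move=> lM; rewrite points_lattice; apply: card_cylinder => //.
- exact: scaled_trig.
- exact: scaled_int.
- exact: scaled_diag.
- exact: scaled_lord.
- exact: Q_int.
move=> y; have -> : lattice (L' *m Q) = cdivide f X.
  by rewrite /X cdivide_lattice TE /L' mulmxA.
apply: dual_cdivide_min => //; first exact: ldeg_ge0_neq0.
rewrite big_split sumrB /= sumr_const card_ord.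
have -> : \sum_j (l j)%:Z = (\sum_j l j)%N%:Z.
  by rewrite -[RHS]natz natr_sum; apply: eq_bigr => j _; rewrite natz.
by rewrite natz.
Qed.

(* Minkowski's bound: otherwise the first m + 1 digits in one coordinate
   would be arbitrary on a set of b^m points. *)
Lemma lattice_min_le :
  (lattice_min X <= ((\sum_j n j)%:Z + 1 - e.+1%:Z + \sum_j lord (f j 0))%:E)%E.
Proof.
rewrite leNgt; apply/negP => lM.
pose l (j : 'I_e.+1) := if j == ord0 then (\sum_j n j).+1 else 0%N.
have lE : (\sum_j l j = (\sum_j n j).+1)%N.
  by rewrite (bigD1 ord0)//= big1 /l ?eqxx ?addn0// => j /negPf ->.
have [] := @card_points_cylinder l 0.
  by rewrite lE -addn1 PoszD.
by move=> k; rewrite lE; lia.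
Qed.

End Assembly.

(** * The net property and the discrepancy bound *)

Lemma digits_sum0 (F : fieldType) d (l : 'I_d -> nat) :
  (\sum_j l j = 0)%N -> forall u v : 'rV[F]_#|{: {j : 'I_d & 'I_(l j)}}|, u = v.
Proof.
move=> l0 u v; apply/rowP => k.
by have := ltn_ord k; rewrite [X in (_ < X)%N]card_digit_index l0.
Qed.

Theorem corollary3p9 (R : realType) (b d : nat) (hb : prime b) (hd : (0 < d)%N) :
  exists2 C : R, 0 < C &
  forall (T L Q : 'M[laurent 'F_b]_d) (f : 'cV[laurent 'F_b]_d),
    T \in unitmx ->
    admissible (lattice T) ->
    T = L *m Q ->
    is_trig_mx L ->
    (forall i j, (ldeg (Q i j) <= 0)%E) ->
    \det Q = 1 ->
    (forall j, (0 <= ldeg (f j 0%R))%E) ->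
    (forall j i : 'I_d, (i <= j)%N -> (ldeg (L j i) <= ldeg (f j 0%R))%E) ->
  let X := lattice T in
  let P := cdivide f X `&` @unit_cube 'F_b d in
  let N := #|` fset_set P| in
  let D := star_discrepancy P (map_mx (@lphi b R)) in
  let s := fine (\sum_j ldeg (f j 0%R) + lattice_min X)%E + d%:Z - 1 in
  exists t m : nat,
    [/\ ((t%:Z)%:E = - ldeg (\det T) - lattice_min X - (d%:Z)%:E + 1)%E,
        ((m%:Z)%:E = - ldeg (\det T) + \sum_j ldeg (f j 0%R))%E,
        finite_set P /\ N = (b ^ m)%N,
        (1 <= m)%N -> (t <= m)%N -> is_net t m P &
        ((1 < d)%N -> (t < m)%N) ->
          let B := C * b%:R ^+ t * (ln N%:R / ln b%:R - t%:R) ^+ d.-1 / N%:R in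
          (D <= B%:E)%E /\ B = C * s%:~R ^+ d.-1 / b%:R ^ s].
Proof.
case: d hd => // e _; have b_gt1 := prime_gt1 hb.
have b0 : 0 < b%:R :> R by rewrite ltr0n (ltnW b_gt1).
have bX0 k : 0 < b%:R ^+ k :> R by rewrite exprn_gt0.
(* The factor 2 comes from k + 1 <= 2 k for k = m - t >= 1; the summand e + 1 = d pays for rounding
   the corners. *)
exists ((b%:R *+ 2) ^+ e + e.+1%:R).
  by rewrite addr_gt0// exprn_gt0// mulrn_wgt0.
move=> T L Q f T_unit X_adm TE L_trig Q_deg Q_det f_deg fL_deg X P N D s.
set C := _ ^+ e + _.
have f0 := ldeg_ge0_neq0 f_deg.
have P_card := card_points hb T_unit TE L_trig Q_deg Q_det f_deg fL_deg.
have P_cyl := card_points_cylinder hb T_unit TE L_trig Q_deg Q_det f_deg fL_deg.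
have M_le := lattice_min_le hb T_unit TE L_trig Q_deg Q_det f_deg fL_deg.
have mE := sum_lord_scaled hb T_unit TE L_trig Q_det f_deg fL_deg.
rewrite -/X in P_card P_cyl M_le; rewrite -/P in P_card P_cyl.
set m := (\sum_j _)%N in P_card P_cyl mE M_le.
set Phi := \sum_j lord (f j 0) in P_cyl mE M_le.
have detT0 : \det T != 0 by rewrite -unitfE -unitmxE.
have degfE : (\sum_j ldeg (f j 0%R))%E = (- Phi)%:E.
  by rewrite /Phi -sumrN -sumEFin; apply: eq_bigr => j _; rewrite ldegE.
(* Admissibility excludes -oo, and [lattice_min_le] excludes +oo. *)
have [z zM] : exists z : int, lattice_min X = z%:E.
  move: X_adm M_le; rewrite /admissible -/X.
  by case: (lattice_min X) => [z| |]// _ _; exists z.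
rewrite zM lee_fin in M_le; rewrite zM in P_cyl.
(* This integer is nonnegative by [lattice_min_le], so [absz] does not change it. *)
pose t := absz (lord (\det T) - z - e.+1%:Z + 1).
have tE : t%:Z = lord (\det T) - z - e.+1%:Z + 1 by rewrite /t; lia.
have P_fin : finite_set P by apply/finite_setP; eexists; exact: P_card.
have NE : N = (b ^ m)%N by apply: card_fset_set.
have net_cyl (l : 'I_e.+1 -> nat) v : (\sum_j l j = m - t)%N -> (t <= m)%N ->
    (P `&` [set g | digits l g = v] #= `I_(b ^ t))%card.
  (* A total of m - t digits puts the degree sum at M(X) - 1, just below the minimum. *)
  move=> lE tm; have [|k mk] := P_cyl l v; first by rewrite lte_fin lE; lia.
  by have -> : k = t by lia.
have sE : s = m%:Z - t%:Z.
  by rewrite /s zM degfE /=; lia.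
have P_cube : P `<=` @unit_cube 'F_b e.+1 by move=> g [_ gU].
exists t, m; split.
- by rewrite ldegE// zM tE -!EFinN opprK -!EFinD.
- by rewrite ldegE// degfE -EFinN opprK -EFinD mE.
- by [].
- move=> m1 tm; split => //.
  move=> l c lE; cbv zeta.
  pose h j : laurent 'F_b := \sum_(1 <= i < (l j).+1) lmonom (c j i) i%:Z.
  pose hc := \col_j h j : 'cV[laurent 'F_b]_e.+1.
  have hU : unit_cube hc.
    apply/unit_cubeP => j; rewrite mxE /h big_add1 big_mkord.
    apply: lord_ge_sum => i _ k k1; rewrite lcoef_monom.
    by case: eqP k1 => // ->; lia.
  rewrite [X in (X #= _)%card](_ : _ = P `&` [set g | digits l g = digits l hc]).
    exact: net_cyl.
  apply/seteqP; split=> g [Pg gh]; split => //.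
    apply/digits_eqP => // [|j]; first by case: Pg.
    by rewrite mxE; apply/ldeg_lt/gh.
  move=> j; apply/ldeg_lt; move: gh => /digits_eqP-/(_ (proj2 Pg) hU j).
  by rewrite mxE.
have lnNE : ln N%:R / ln b%:R = m%:R :> R.
  rewrite NE natrX lnXn// -[ln _ *+ _]mulr_natl mulfK//.
  by rewrite gt_eqF// ln_gt0// ltr1n.
move=> tm B; rewrite /B lnNE NE natrX; split; last first.
  have -> : s%:~R = m%:R - t%:R :> R by rewrite sE intrB.
  have -> : b%:R ^ s = b%:R ^+ m / b%:R ^+ t :> R.
    by rewrite sE expfzDr ?gt_eqF// -invr_expz.
  by rewrite invf_div mulrA; congr (_ / _); rewrite mulrAC.
(* Here t > m leaves only d = 1. With no digits prescribed, P is a net with m in place of t; the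
   bound becomes 2 = C, and b^t / b^m >= 1. *)
have [t_m|m_t] := leqP t m; last first.
  have e0 : e = 0%N by have [//|e_gt0] := posnP e; have := tm e_gt0; lia.
  rewrite -[m]addn0 in P_card.
  apply: le_trans (net_star_discrepancy R hb P_cube P_card _) _.
    move=> l v l0; have -> : P `&` [set g | digits l g = v] = P; last first.
      by move: P_card; rewrite addn0.
    by apply/seteqP; split=> [g []//|g Pg]; split => //; apply: digits_sum0.
  rewrite lee_fin /C e0 !expr0 !mulr1 divr1 -mulrA ler_peMr ?addr_ge0//.
  by rewrite ler_pdivlMr// mul1r ler_weXn2l// ?ler1n ?(ltnW b_gt1)// ltnW.
pose k := (m - t)%N; have mk : m = (t + k)%N by rewrite subnKC.
rewrite mk in P_card.
apply: le_trans (net_star_discrepancy R hb P_cube P_card _) _.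
  by move=> l v lE; apply: net_cyl.
rewrite lee_fin -natrB// -/k mk exprD.
rewrite [C * _ * _]mulrAC invfM mulrA mulfK ?gt_eqF//.
rewrite ler_pM2r ?invr_gt0// /C mulrDl.
(* For e = 0 both powers are 1, even if k = 0; for e > 0 the hypothesis gives k >= 1. *)
have [e0|e_gt0] := posnP e; first by rewrite e0 !expr0 !mulr1.
have k1 : (1 <= k)%N by have := tm e_gt0; lia.
have k1R : 1 <= k%:R :> R by rewrite ler1n.
apply: lerD; last by rewrite ler_peMr// exprn_ege1.
rewrite -exprMn lerXn2r ?nnegrE ?mulr_ge0// ?(ltW b0) ?mulrn_wge0 ?(ltW b0)//.
have : b%:R <= b%:R * k%:R :> R by rewrite ler_peMr// ltW.
rewrite -[k.+1%:R]natr1; lra.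
Qed.
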